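(* Let $\mathbb{K}\in\{\mathbb{R},\mathbb{C}\}$, let $B,\bar B$ be Banach spaces over $\mathbb{K}$, and let $L(\varepsilon)=\sum_{i=0}^{\infty}\varepsilon^i L_i$ be an analytic family (defined for $\varepsilon\in\mathbb{K}$ near $0$) of bounded linear operators $L_i\in L[B,\bar B]$, $L(\varepsilon)\not\equiv 0$. Let $k\ge 0$ and assume that $L(\varepsilon)$ stabilizes at $k$. Run the recursion of the context with some choice of complements, and assume that the projections $P_i:B\to N_i^c$ and $\mathcal P_i:\bar B\to R_i$, $i=1,\dots,k+1$, are continuous. Define $$\phi(\varepsilon)=I_B+\sum_{i=1}^\infty \varepsilon^i M_{k+1,k+1+i},\qquad \psi(\varepsilon)=I_{\bar B}+\sum_{i=1}^\infty\varepsilon^i\psi_i,\quad \psi_i=\sum_{j=1}^{k+1} S_{i+j}S_j^{-1}\mathcal P_j,$$ $$\Delta(\varepsilon)=S_1P_1+\varepsilon S_2P_2+\cdots+\varepsilon^kS_{k+1}P_{k+1}.$$ Then there is an open neighbourhood $U$ of $0$ in $\mathbb{K}$ such that the following hold. (i) $\phi$ is an analytic family in $L[B,B]$ on $U$ with $\phi(0)=I_B$ (a near identity transformation), and $$S(\varepsilon):=L(\varepsilon)\phi(\varepsilon)=\sum_{i=0}^\infty\varepsilon^iS_{i+1}$$ is analytic, where for $i=1,\dots,k+1$: $S_i(N_0^c+\cdots+N_{i-1}^c)\subset R_{i-1}^c$, $S_i(N_i^c)=R_i$ and $S_i(N_i)=\{0\}$; and for all $l\ge 2$: $R[S_{k+l}]\subset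 R_{k+1}^c$ and $S_{k+l}(N_{k+1})=\{0\}$. (ii) $\psi$ is an analytic family in $L[\bar B,\bar B]$ on $U$ with $\psi(0)=I_{\bar B}$ (a near identity transformation), and $\psi^{-1}(\varepsilon)\,L(\varepsilon)\,\phi(\varepsilon)=\Delta(\varepsilon)$ on $U$. (iii) For $\varepsilon\in U\setminus\{0\}$, $$N[L(\varepsilon)]=\phi(\varepsilon)N_{k+1},\qquad R[L(\varepsilon)]=\psi(\varepsilon)[R_1\oplus\cdots\oplus R_{k+1}].$$ In particular the kernels $N[L(\varepsilon)]$ and ranges $R[L(\varepsilon)]$, $\varepsilon\neq0$, are analytically embedded into the families $N(\varepsilon)=\phi(\varepsilon)N_{k+1}$ and $R(\varepsilon)=\psi(\varepsilon)[R_1\oplus\cdots\oplus R_{k+1}]$, $\varepsilon\in U$. (iv) For $\varepsilon\ne0$ the family $$\Delta^{-1}(\varepsilon)=\varepsilon^{-k}S_{k+1}^{-1}\mathcal P_{k+1}+\cdots+\varepsilon^{-1}S_2^{-1}\mathcal P_2+S_1^{-1}\mathcal P_1$$ is a generalized inverse of $\Delta(\varepsilon)$ with pole of order $k$ at $\varepsilon=0$. The family $L^{-1}(\varepsilon)=\phi(\varepsilon)\Delta^{-1}(\varepsilon)\psi^{-1}(\varepsilon)$ is a generalized inverse of $L(\varepsilon)$ which is analytic on $U\setminus\{0\}$ with pole of order $k$ at $\varepsilon=0$. For $\varepsilon\in U\setminus\{0\}$, $$L^{-1}(\varepsilon)L(\varepsilon)=\phi(\varepsilon)(P_1+\cdots+P_{k+1})\phi^{-1}(\varepsilon),\qquad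 L(\varepsilon)L^{-1}(\varepsilon)=\psi(\varepsilon)(\mathcal P_1+\cdots+\mathcal P_{k+1})\psi^{-1}(\varepsilon),$$ and these are projections onto $\phi(\varepsilon)[N_1^c\oplus\cdots\oplus N_{k+1}^c]\subset B$ and onto $R[L(\varepsilon)]=\psi(\varepsilon)[R_1\oplus\cdots\oplus R_{k+1}]\subset\bar B$, respectively. Both families continue analytically to $\varepsilon=0$ with values $P_1+\cdots+P_{k+1}$ and $\mathcal P_1+\cdots+\mathcal P_{k+1}$, respectively.
   Context: $L[X,Y]$ denotes bounded linear operators and $L(X,Y)$ all linear maps; $N[T]$ and $R[T]$ are the kernel and range of $T$; $I_X$ is the identity. ''Analytic'' means given locally by a power series convergent in operator norm. A generalized inverse of $T$ is an operator $T^{-1}$ with $TT^{-1}T=T$ and $T^{-1}TT^{-1}=T^{-1}$. A pole of order $k\ge0$ at $0$ means that the Laurent expansion starts with a nonzero coefficient at $\varepsilon^{-k}$ (for $k=0$: an analytic family with nonzero value at $0$). Stabilization. For $k\ge1$ let $\Delta^k:B^k\to\bar B^k$ be the upper triangular block Toeplitz operator with $(i,j)$ entry $L_{j-i}$ for $j\ge i$ and $0$ otherwise, so that $\Delta^k(b_{k-1},\dots,b_0)^T=0$ iff $\sum_{i+j=m}L_ib_j=0$ for $m=0,\dots,k-1$. For $b_0\in B$ put $\mathrm{rank}(b_0)=0$ if $b_0\notin N[L_0]$, and otherwise $\mathrm{rank}(b_0)=\sup\{k\ge1\mid\exists (b_{k-1},\dots,b_0)\in B^k:\ \Delta^k(b_{k-1},\dots,b_0)^T=0\}\in\mathbb{N}\cup\{\infty\}$.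 $L(\varepsilon)$ stabilizes at $k\ge0$ if $\mathrm{rank}(b_0)\in\{0,\dots,k\}\cup\{\infty\}$ for all $b_0\in B$ and there exists $b_0$ with $\mathrm{rank}(b_0)=k$. Recursion. Put $N_0:=B$, $N_0^c:=\{0\}$, $R_0:=\{0\}$, $R_0^c:=\bar B$, $\bar S_1:=S_1:=L_0$, $E_{1,1}:=M_{1,1}:=I_B$. At each stage $j\ge1$, given $S_j\in L(B,R_{j-1}^c)$, set $N_j:=\{n\in N_{j-1}\mid S_jn=0\}$, $R_j:=S_j(N_{j-1})$ and choose algebraic direct complements $N_{j-1}=N_j^c\oplus N_j$, $R_{j-1}^c=R_j\oplus R_j^c$. Then $B=N_1^c\oplus\cdots\oplus N_j^c\oplus N_j$ and $\bar B=R_1\oplus\cdots\oplus R_j\oplus R_j^c$; $P_j$ and $\mathcal P_j$ denote the projections onto $N_j^c$ and onto $R_j$ defined by these decompositions (regarded also as maps into $B$, $\bar B$), and $S_j^{-1}:R_j\to N_j^c$ denotes the inverse of the bijection $S_j|_{N_j^c}:N_j^c\to R_j$. At stage $j\ge2$, the operators are defined by $$\bar S_j:=\sum_{i=1}^{j-1}L_iM_{i,j-1},\qquad S_j:=(I_{\bar B}-\mathcal P_1-\cdots-\mathcal P_{j-1})\bar S_j,$$ $$E_{j,j}:=I_B,\qquad E_{i,j}:=-S_i^{-1}\mathcal P_i\sum_{\nu=i+1}^{j}\bar S_\nu E_{\nu,j}\quad (i=j-1,\dots,1),$$ $$M_{1,j}:=E_{1,j},\qquad M_{i,j}:=\sum_{\nu=i}^{j}M_{i-1,\nu-1}E_{\nu,j}\quad(i=2,\dots,j).$$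 (So $M_{j,j}=I_B$.) The recursion is continued for all $j$; the complements are the same choice throughout. *)

(* Defs.v *)
From mathcomp Require Import all_boot all_order all_algebra.
From mathcomp Require Import all_classical all_reals all_analysis.
From mathcomp Require Export complex.

Set Implicit Arguments.
Unset Strict Implicit.
Unset Printing Implicit Defensive.

Import Order.TTheory GRing.Theory Num.Theory.
Import numFieldNormedType.Exports.

Local Open Scope classical_set_scope.
Local Open Scope ring_scope.

Section LinearAlgebra.
Variables (K : fieldType) (V : lmodType K).

Definition lin_subspace (U : set V) : Prop :=
  U 0 /\ forall (a : K) u v, U u -> U v -> U (a *: u + v).

Definition direct_complement (W U U' : set V) : Prop :=
  [/\ lin_subspace U, lin_subspace U', U `&` U' = [set 0] &
      W = [set u + u' | u in U & u' in U']].

(* F m + F (m + 1) + ... + F n *)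
Definition sum_spaces (m n : nat) (F : nat -> set V) : set V :=
  [set x | exists2 c : nat -> V,
     forall i, (m <= i <= n)%N -> F i (c i) & x = \sum_(m <= i < n.+1) c i].

End LinearAlgebra.

Definition op_kernel (K : fieldType) (V W : lmodType K) (T : V -> W) : set V :=
  [set x | T x = 0].

Section Stabilization.
Variables (K : fieldType) (B Bb : lmodType K) (L : nat -> B -> Bb).

(* The block Toeplitz operator Delta^k, with (i, j) entry L_(j - i) if i <= j
   and 0 otherwise. *)
Definition toeplitz (k : nat) (v : 'I_k -> B) : 'I_k -> Bb :=
  fun i => \sum_(j < k | (i <= j)%N) L (j - i) (v j).

(* The tuple passed to [toeplitz] is (b_(k-1), ..., b_0). *)
Definition root_chain (k : nat) (b0 : B) : Prop :=
  exists2 b : nat -> B, b 0%N = b0 &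
    forall i : 'I_k, toeplitz (fun j : 'I_k => b (k.-1 - j)%N) i = 0.

Definition rank (R : realType) (b0 : B) : \bar R :=
  if `[< op_kernel (L 0%N) b0 >]
  then ereal_sup [set k%:R%:E | k in [set k | (1 <= k)%N /\ root_chain k b0]]
  else 0%E.

Definition stabilizes (R : realType) (k : nat) : Prop :=
  (forall b0, (exists2 m, (m <= k)%N & rank R b0 = m%:R%:E) \/
              rank R b0 = +oo%E) /\
  (exists b0, rank R b0 = k%:R%:E).

End Stabilization.

(* One run of the recursion, i.e. a choice of the complements N_j^c, R_j^c
   together with everything that it determines; [rQ] stands for the
   projections \mathcal P_j.  The values of [rSinv j] outside R_j, and those of
   the operators at indices outside the ranges below, are unconstrained. *)
Record recursion (K : fieldType) (B Bb : lmodType K) (L : nat -> B -> Bb) :=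
  Recursion {
  rN : nat -> set B;
  rNc : nat -> set B;
  rR : nat -> set Bb;
  rRc : nat -> set Bb;
  rP : nat -> B -> B;
  rQ : nat -> Bb -> Bb;
  rSbar : nat -> B -> Bb;
  rS : nat -> B -> Bb;
  rSinv : nat -> Bb -> B;
  rE : nat -> nat -> B -> B;
  rM : nat -> nat -> B -> B;
  rN0 : rN 0 = setT;
  rNc0 : rNc 0 = [set 0];
  rR0 : rR 0 = [set 0];
  rRc0 : rRc 0 = setT;
  rSbar1 : forall x, rSbar 1 x = L 0%N x;
  rS1 : forall x, rS 1 x = L 0%N x;
  rE11 : forall x, rE 1 1 x = x;
  rM11 : forall x, rM 1 1 x = x;
  rN_def : forall j, (1 <= j)%N -> rN j = [set n | rN j.-1 n /\ rS j n = 0];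
  rR_def : forall j, (1 <= j)%N -> rR j = rS j @` rN j.-1;
  rNc_compl : forall j, (1 <= j)%N ->
    direct_complement (rN j.-1) (rNc j) (rN j);
  rRc_compl : forall j, (1 <= j)%N ->
    direct_complement (rRc j.-1) (rR j) (rRc j);
  (* B = N_1^c (+) ... (+) N_j^c (+) N_j *)
  rP_def : forall j (c : nat -> B) n, (1 <= j)%N ->
    (forall i, (1 <= i <= j)%N -> rNc i (c i)) -> rN j n ->
    rP j (\sum_(1 <= i < j.+1) c i + n) = c j;
  (* Bb = R_1 (+) ... (+) R_j (+) R_j^c *)
  rQ_def : forall j (c : nat -> Bb) n, (1 <= j)%N ->
    (forall i, (1 <= i <= j)%N -> rR i (c i)) -> rRc j n ->
    rQ j (\sum_(1 <= i < j.+1) c i + n) = c j;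
  (* S_j is a bijection from N_j^c onto R_j *)
  rSinv_def : forall j n, (1 <= j)%N -> rNc j n -> rSinv j (rS j n) = n;
  rSbar_def : forall j x, (2 <= j)%N ->
    rSbar j x = \sum_(1 <= i < j) L i (rM i j.-1 x);
  rS_def : forall j x, (2 <= j)%N ->
    rS j x = rSbar j x - \sum_(1 <= i < j) rQ i (rSbar j x);
  rE_diag : forall j x, (2 <= j)%N -> rE j j x = x;
  rE_def : forall i j x, (1 <= i < j)%N ->
    rE i j x = - rSinv i (rQ i (\sum_(i.+1 <= v < j.+1) rSbar v (rE v j x)));
  rM1_def : forall j x, (2 <= j)%N -> rM 1 j x = rE 1 j x;
  rM_def : forall i j x, (2 <= i <= j)%N ->
    rM i j x = \sum_(i <= v < j.+1) rM i.-1 v.-1 (rE v j x)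
}.

Section Operators.
Variables (K : numFieldType).

Definition bounded_op (V W : normedModType K) (T : V -> W) : Prop :=
  linear T /\ continuous T.

(* T = \sum_i a_i A_i in operator norm: the norm of T minus the n-th partial
   sum is eventually at most e, for every e > 0. *)
Definition op_sum (V W : normedModType K)
    (a : nat -> K) (A : nat -> V -> W) (T : V -> W) : Prop :=
  forall e : K, 0 < e -> \forall n \near \oo, forall x : V,
    `|T x - \sum_(i < n) a i *: A i x| <= e * `|x|.

(* the pointwise value of \sum_i z^i A_i; meaningful where the series
   converges *)
Definition op_series (V W : normedModType K)
    (A : nat -> V -> W) (z : K) : V -> W :=
  fun x => limn (fun n => \sum_(i < n) z ^+ i *: A i x).

(* F z = \sum_i z^i A_i on U, as a power series of bounded operators *)
Definition power_series_on (V W : normedModType K)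
    (U : set K) (A : nat -> V -> W) (F : K -> V -> W) : Prop :=
  (forall i, bounded_op (A i)) /\
  (forall z, U z -> op_sum (fun i => z ^+ i) A (F z)).

Definition analytic_on (V W : normedModType K)
    (U : set K) (F : K -> V -> W) : Prop :=
  forall z0, U z0 -> exists2 A : nat -> V -> W, forall i, bounded_op (A i) &
    \forall z \near z0, op_sum (fun i => (z - z0) ^+ i) A (F z).

(* The Laurent expansion \sum_i z^(i - k) A_i of F at 0 has A_0 <> 0.  At z = 0
   it is only required to represent F when k = 0. *)
Definition pole_of_order (V W : normedModType K)
    (k : nat) (F : K -> V -> W) : Prop :=
  exists A : nat -> V -> W,
    [/\ forall i, bounded_op (A i), exists x, A 0%N x != 0 &
        \forall z \near (0 : K), (z != 0) || (k == 0%N) ->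
          op_sum (fun i => z ^- k * z ^+ i) A (F z)].

Definition inverse_op (V : normedModType K) (T T' : V -> V) : Prop :=
  [/\ bounded_op T', cancel T T' & cancel T' T].

(* near identity transformation T on U, with pointwise inverse Tinv *)
Definition near_identity (V : normedModType K)
    (U : set K) (T Tinv : K -> V -> V) : Prop :=
  [/\ analytic_on U T, forall x, T 0 x = x &
      forall z, U z -> inverse_op (T z) (Tinv z)].

Definition generalized_inverse (V W : normedModType K)
    (T : V -> W) (T' : W -> V) : Prop :=
  [/\ bounded_op T', forall x, T (T' (T x)) = T x &
      forall y, T' (T (T' y)) = T' y].

Definition projection_onto (V : normedModType K)
    (T : V -> V) (X : set V) : Prop :=
  [/\ bounded_op T, forall x, T (T x) = T x & range T = X].

(* F, a family of operators on U minus 0, continues analytically to 0 with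
   value T0 *)
Definition continues_to_0 (V W : normedModType K)
    (U : set K) (F : K -> V -> W) (T0 : V -> W) : Prop :=
  exists G : K -> V -> W,
    [/\ analytic_on U G, forall z, U z -> z != 0 -> G z =1 F z & G 0 =1 T0].

(* The subspaces F z, z in U minus 0, belong to the analytic family of
   subspaces G z, z in U: the image of a fixed subspace under a near identity
   transformation. *)
Definition analytically_embedded (V : normedModType K)
    (U : set K) (F G : K -> set V) : Prop :=
  (exists T Tinv (X : set V), [/\ near_identity U T Tinv, lin_subspace X &
     forall z, U z -> G z = T z @` X]) /\
  (forall z, U z -> z != 0 -> F z = G z).

End Operators.

Section Transformations.
Variables (K : numFieldType) (B Bb : normedModType K) (L : nat -> B -> Bb).
Variables (D : recursion L) (k : nat).

Definition phi_coef (i : nat) : B -> B :=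
  if i is 0 then id else rM D k.+1 (k.+1 + i).

Definition phi (z : K) : B -> B := op_series phi_coef z.

Definition psi_coef (i : nat) : Bb -> Bb :=
  if i is 0 then id
  else fun y => \sum_(1 <= j < k.+2) rS D (i + j) (rSinv D j (rQ D j y)).

Definition psi (z : K) : Bb -> Bb := op_series psi_coef z.

Definition Delta (z : K) : B -> Bb :=
  fun x => \sum_(1 <= j < k.+2) z ^+ j.-1 *: rS D j (rP D j x).

Definition Delta_inv (z : K) : Bb -> B :=
  fun y => \sum_(1 <= j < k.+2) z ^- j.-1 *: rSinv D j (rQ D j y).

(* P_1 + ... + P_(k+1) *)
Definition sumP : B -> B := fun x => \sum_(1 <= j < k.+2) rP D j x.

(* \mathcal P_1 + ... + \mathcal P_(k+1) *)
Definition sumQ : Bb -> Bb := fun y => \sum_(1 <= j < k.+2) rQ D j y.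

End Transformations.

(* Main.v *)
From HB Require Import structures.
Require Import Defs.
From mathcomp Require Import all_boot all_order all_algebra.
From mathcomp Require Import all_classical all_reals all_analysis.
From mathcomp Require Import zify ring lra.

Set Implicit Arguments.
Unset Strict Implicit.
Unset Printing Implicit Defensive.

Import Order.TTheory GRing.Theory Num.Theory.
Import numFieldNormedType.Exports.

Local Open Scope classical_set_scope.
Local Open Scope ring_scope.

(* Let M be the infinite upper triangular operator matrix
   (M_(i, j)); the recursion says that M conjugates the block Toeplitz operator
   of L into that of S.  Hence b_0 starts a root chain of length j if and only
   if b_0 lies in N_j, so stabilization at k makes N_j, R_j^c constant for
   j > k, which in turn makes M Toeplitz from row k + 1 on: its entries are the
   coefficients of phi, and L phi = S.  On N_j^c all S_i with i < j vanish and
   S_j is inverted by S_j^-1, which gives S = psi Delta coefficient by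
   coefficient; kernels, ranges and generalized inverses are then read off from
   the diagonal family Delta.

   The operators S_j^-1 \mathcal P_j are bounded by the closed graph theorem.
   Beyond column k + 1 the recursion only involves finitely many of them, so
   the M_(i, j) grow at most geometrically in j and all series converge near
   0. *)

(** * Linear maps and flags of subspaces *)

(** The conjugation rests on two cancellations. Within a column, E is back substitution: it removes
    from the sum of the Sb_v E_(v,j) all components in R_1, ..., R_(j-1), which leaves S_j. From one
    row to the next, the off-diagonal E_(v,c) takes values in N_(v-1), where every S of index below
    v vanishes, so only the diagonal term survives. For root chains, the vanishing of the residuals
    alone does not sustain an induction. It must also record that the next residual of a chain of
    length m lies in R_1 + ... + R_(m+1), a space that meets R_(m+1)^c only in 0. Since the scalars
    may be real, analyticity is handled by power series alone. The predicate [expands] keeps a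
    geometric bound on the coefficients together with convergence on a disc; it is stable under
    composition, inversion and change of centre, and the families of the theorem are built by these
    operations. Equality of two families near 0 then reduces to equality of coefficients. *)

Section LinearMaps.
Variables (K : fieldType) (U V W : lmodType K).
Implicit Types (f g : U -> V).

Lemma lin_map0 f : linear f -> f 0 = 0.
Proof.
move=> lf; have := lf 1 0 0; rewrite !scale1r addr0 => h.
by apply: (addrI (f 0)); rewrite addr0 -h.
Qed.

Lemma lin_mapD f : linear f -> forall x y, f (x + y) = f x + f y.
Proof. by move=> lf x y; have := lf 1 x y; rewrite !scale1r. Qed.

Lemma lin_mapZ f : linear f -> forall a x, f (a *: x) = a *: f x.
Proof. by move=> lf a x; have := lf a x 0; rewrite lin_map0 // !addr0. Qed.

Lemma lin_mapN f : linear f -> forall x, f (- x) = - f x.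
Proof. by move=> lf x; rewrite -scaleN1r lin_mapZ // scaleN1r. Qed.

Lemma lin_mapB f : linear f -> forall x y, f (x - y) = f x - f y.
Proof. by move=> lf x y; rewrite lin_mapD // lin_mapN. Qed.

Lemma lin_map_sum f : linear f -> forall I (r : seq I) (P : pred I) (F : I -> U),
  f (\sum_(i <- r | P i) F i) = \sum_(i <- r | P i) f (F i).
Proof. by move=> lf I r P F; rewrite (big_morph f (lin_mapD lf) (lin_map0 lf)). Qed.

Lemma linear_compP (g : V -> W) f : linear g -> linear f ->
  linear (fun x => g (f x)).
Proof. by move=> lg lf a x y; rewrite lf lg. Qed.

Lemma linear_zeroP : linear (fun _ : U => 0 : V).
Proof. by move=> a x y; rewrite scaler0 addr0. Qed.

Lemma linear_addP f g : linear f -> linear g -> linear (fun x => f x + g x).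
Proof. by move=> lf lg a x y; rewrite lf lg scalerDr addrACA. Qed.

Lemma linear_oppP f : linear f -> linear (fun x => - f x).
Proof. by move=> lf a x y; rewrite lf opprD scalerN. Qed.

Lemma linear_subP f g : linear f -> linear g -> linear (fun x => f x - g x).
Proof. by move=> lf lg; apply: linear_addP => //; apply: linear_oppP. Qed.

Lemma linear_scaleP (b : K) f : linear f -> linear (fun x => b *: f x).
Proof. by move=> lf a x y; rewrite lf scalerDr !scalerA mulrC. Qed.

Lemma linear_sum_natP (m n : nat) (F : nat -> U -> V) :
  (forall i, (m <= i < n)%N -> linear (F i)) ->
  linear (fun x => \sum_(m <= i < n) F i x).
Proof.
move=> lF a x y; rewrite scaler_sumr -big_split /= !big_nat.
by apply: eq_bigr => i mi; rewrite lF.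
Qed.

Lemma linear_extP f g : f =1 g -> linear g -> linear f.
Proof. by move=> fg lg a x y; rewrite !fg lg. Qed.

End LinearMaps.

Section Subspaces.
Variables (K : fieldType) (V : lmodType K) (X : set V).
Hypothesis sX : lin_subspace X.

Lemma subspace0 : X 0. Proof. by case: sX. Qed.

Lemma subspaceD x y : X x -> X y -> X (x + y).
Proof. by move=> Xx Xy; rewrite -[x]scale1r; apply: sX.2. Qed.

Lemma subspaceZ a x : X x -> X (a *: x).
Proof. by move=> Xx; rewrite -[_ *: _]addr0; apply: sX.2 => //; apply: subspace0. Qed.

Lemma subspaceN x : X x -> X (- x).
Proof. by move=> Xx; rewrite -scaleN1r; apply: subspaceZ. Qed.

Lemma subspace_sum (m n : nat) (c : nat -> V) :
  (forall i, (m <= i < n)%N -> X (c i)) -> X (\sum_(m <= i < n) c i).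
Proof.
move=> Xc; rewrite big_nat; apply: (big_ind X) => //.
- exact: subspace0.
- by move=> *; apply: subspaceD.
Qed.

End Subspaces.

Section Flags.
Variables (K : fieldType) (V : lmodType K).
Variables (F W : nat -> set V) (p : nat -> V -> V).
Hypothesis W0 : W 0%N = setT.
Hypothesis FW : forall j, (1 <= j)%N -> direct_complement (W j.-1) (F j) (W j).
Hypothesis pE : forall j (c : nat -> V) n, (1 <= j)%N ->
  (forall i, (1 <= i <= j)%N -> F i (c i)) -> W j n ->
  p j (\sum_(1 <= i < j.+1) c i + n) = c j.

Lemma flag_subspace j : lin_subspace (W j).
Proof.
case: j => [|j]; first by rewrite W0.
by have [] := @FW j.+1 isT.
Qed.

Lemma flag_piece_subspace j : (1 <= j)%N -> lin_subspace (F j).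
Proof. by move=> /FW []. Qed.

Lemma flag_decr i j : (i <= j)%N -> W j `<=` W i.
Proof.
elim: j => [|j IH]; first by rewrite leqn0 => /eqP ->.
rewrite leq_eqVlt => /orP[/eqP -> //|]; rewrite ltnS => /IH; apply: subset_trans.
have [[F0 _] _ _ /= ->] := @FW j.+1 isT.
by move=> x Wx; exists 0 => //; exists x => //; rewrite add0r.
Qed.

Lemma flag_piece_sub j : (1 <= j)%N -> F j `<=` W j.-1.
Proof.
move=> j1; have [_ [W0' _] _ ->] := FW j1.
by move=> x Fx; exists x => //; exists 0 => //; rewrite addr0.
Qed.

Lemma flag_decomp j x : exists (c : nat -> V) n,
  [/\ forall i, (1 <= i <= j)%N -> F i (c i), W j n &
      x = \sum_(1 <= i < j.+1) c i + n].
Proof.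
elim: j => [|j [c [n [Fc Wn ->]]]].
  exists (fun=> 0), x; split; rewrite ?W0 ?big_geq ?add0r //.
  by move=> i; rewrite leqn0 => /andP[/lt0n_neq0 /negPf ->].
have [_ _ _ WE] := @FW j.+1 isT.
move: Wn; rewrite [j.+1.-1]/= in WE; rewrite WE => -[u Fu [u' Wu' <-]].
exists (fun i => if i == j.+1 then u else c i), u'; split => //.
  move=> i; case: eqP => [-> //|ij /andP[i1 ij1]]; apply: Fc; lia.
rewrite [in RHS]big_nat_recr //= eqxx -!addrA; congr (_ + _).
by rewrite !big_nat; apply: eq_bigr => i ?; case: eqP => // ?; lia.
Qed.

(** [pE] reads off only the last piece of a decomposition. For an earlier piece [i], everything
    after position [i] lies in [W i] and is absorbed into the remainder of the decomposition of
    length [i]. *)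
Lemma flag_proj_sum i j (c : nat -> V) n : (1 <= i <= j)%N ->
  (forall i, (1 <= i <= j)%N -> F i (c i)) -> W j n ->
  p i (\sum_(1 <= i < j.+1) c i + n) = c i.
Proof.
move=> /andP[i1 ij] Fc Wn.
rewrite (@big_cat_nat _ _ _ i.+1) //= -addrA; apply: pE => //.
  by move=> a ?; apply: Fc; lia.
apply: subspaceD; [exact: flag_subspace| |exact: flag_decr Wn].
apply: subspace_sum => [|a ia]; first exact: flag_subspace.
apply: (@flag_decr i a.-1); first lia.
by apply: flag_piece_sub; [lia | apply: Fc; lia].
Qed.

Lemma flag_proj_in j x : (1 <= j)%N -> F j (p j x).
Proof.
move=> j1; have [c [n [Fc Wn ->]]] := flag_decomp j x.
by rewrite flag_proj_sum ?j1 ?leqnn //; apply: Fc; rewrite j1 leqnn.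
Qed.

Lemma flag_residual j x : W j (x - \sum_(1 <= i < j.+1) p i x).
Proof.
have [c [n [Fc Wn ->]]] := flag_decomp j x.
rewrite (_ : \sum_(_ <= _ < _) p _ _ = \sum_(1 <= i < j.+1) c i).
  by rewrite [_ + n]addrC addrK.
by apply: eq_big_nat => i ij; rewrite flag_proj_sum.
Qed.

Lemma flag_proj_linear j : (1 <= j)%N -> linear (p j).
Proof.
move=> j1 a x y.
have [c [n [Fc Wn ->]]] := flag_decomp j x.
have [d [m [Fd Wm ->]]] := flag_decomp j y.
rewrite (_ : a *: _ + _ = \sum_(1 <= i < j.+1) (a *: c i + d i) + (a *: n + m)).
  rewrite !pE //.
    by move=> i ij; apply: (flag_piece_subspace _).2; [lia|apply: Fc|apply: Fd].
  by apply: (flag_subspace _).2.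
by rewrite big_split /= -scaler_sumr scalerDr !addrA (addrAC (a *: _) (a *: n)).
Qed.

Lemma flag_proj_sub i j x : (1 <= i <= j)%N -> W j x -> p i x = 0.
Proof.
move=> ij Wx; have /= := @flag_proj_sum i j (fun=> 0) x ij.
rewrite big1_eq add0r; apply => // a ja.
by apply: subspace0; apply: flag_piece_subspace; lia.
Qed.

Lemma flag_proj_piece i j x : (1 <= i)%N -> (1 <= j)%N -> F j x ->
  p i x = if i == j then x else 0.
Proof.
(* [x] alone at position [j] is a decomposition of length [i + j], long enough for both indices to
   occur. *)
move=> i1 j1 Fx; pose c a := if a == j then x else 0.
have xE : x = \sum_(1 <= a < (i + j).+1) c a + 0.
  rewrite addr0 (bigD1_seq j) /= ?iota_uniq //.
    by rewrite /c eqxx big1 ?addr0 // => a /negPf ->.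
  by rewrite mem_index_iota; lia.
rewrite {1}xE (@flag_proj_sum i (i + j) c) //; [lia | | ].
  move=> a ?; rewrite /c; case: eqP => [-> //|_].
  by apply: subspace0; apply: flag_piece_subspace; lia.
by apply: subspace0; apply: flag_subspace.
Qed.

Lemma flag_mem j x : (forall i, (1 <= i <= j)%N -> p i x = 0) -> W j x.
Proof.
move=> px; have := flag_residual j x.
by rewrite big_nat big1 ?subr0 // => i ij; apply: px.
Qed.

(** Membership in a sum of pieces becomes a fixed-point equation, the form in which ranges of
    projections are computed later. *)
Lemma flag_sum_spaces j x :
  sum_spaces 1 j F x <-> \sum_(1 <= i < j.+1) p i x = x.
Proof.
split=> [[c Fc ->]|<-].
  rewrite -[\sum_(1 <= i < j.+1) c i]addr0; apply: eq_trans (esym (addr0 _)).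
  apply: eq_big_nat => i ij; apply: flag_proj_sum => //.
  by apply: subspace0; apply: flag_subspace.
exists (fun i => p i x) => // i ij.
by apply: flag_proj_in; lia.
Qed.

End Flags.

(** * The recursion *)

Section Recursion.
Variables (K : fieldType) (B Bb : lmodType K) (L : nat -> B -> Bb).
Hypothesis L_linear : forall i, linear (L i).
Variable D : recursion L.

Local Notation N := (rN D).
Local Notation Nc := (rNc D).
Local Notation Rg := (rR D).
Local Notation Rc := (rRc D).
Local Notation P := (rP D).
Local Notation Q := (rQ D).
Local Notation Sb := (rSbar D).
Local Notation S := (rS D).
Local Notation E := (rE D).
Local Notation M := (rM D).
Local Notation T := (fun j y => rSinv D j (rQ D j y)).

(** Two flags with opposite roles: in [B] the kernels N_j decrease and the N_j^c are the pieces; in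
    [Bb] the complements R_j^c decrease and the R_j are the pieces. *)
Definition N_subspace := flag_subspace (rN0 D) (@rNc_compl _ _ _ _ D).
Definition N_decr := flag_decr (@rNc_compl _ _ _ _ D).
Definition Nc_subspace := flag_piece_subspace (@rNc_compl _ _ _ _ D).
Definition Nc_sub := flag_piece_sub (@rNc_compl _ _ _ _ D).
Definition P_in := flag_proj_in (rN0 D) (@rNc_compl _ _ _ _ D) (@rP_def _ _ _ _ D).
Definition P_residual :=
  flag_residual (rN0 D) (@rNc_compl _ _ _ _ D) (@rP_def _ _ _ _ D).
Definition P_linear :=
  flag_proj_linear (rN0 D) (@rNc_compl _ _ _ _ D) (@rP_def _ _ _ _ D).
Definition P_N := flag_proj_sub (rN0 D) (@rNc_compl _ _ _ _ D) (@rP_def _ _ _ _ D).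
Definition P_Nc :=
  flag_proj_piece (rN0 D) (@rNc_compl _ _ _ _ D) (@rP_def _ _ _ _ D).
Definition sum_Nc :=
  flag_sum_spaces (rN0 D) (@rNc_compl _ _ _ _ D) (@rP_def _ _ _ _ D).
Definition N_mem := flag_mem (rN0 D) (@rNc_compl _ _ _ _ D) (@rP_def _ _ _ _ D).

Definition Rc_decr := flag_decr (@rRc_compl _ _ _ _ D).
Definition Q_in := flag_proj_in (rRc0 D) (@rRc_compl _ _ _ _ D) (@rQ_def _ _ _ _ D).
Definition Q_residual :=
  flag_residual (rRc0 D) (@rRc_compl _ _ _ _ D) (@rQ_def _ _ _ _ D).
Definition Q_linear :=
  flag_proj_linear (rRc0 D) (@rRc_compl _ _ _ _ D) (@rQ_def _ _ _ _ D).
Definition Q_Rc := flag_proj_sub (rRc0 D) (@rRc_compl _ _ _ _ D) (@rQ_def _ _ _ _ D).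
Definition Q_R :=
  flag_proj_piece (rRc0 D) (@rRc_compl _ _ _ _ D) (@rQ_def _ _ _ _ D).
Definition sum_R :=
  flag_sum_spaces (rRc0 D) (@rRc_compl _ _ _ _ D) (@rQ_def _ _ _ _ D).
Lemma S_N j x : (1 <= j)%N -> N j x -> S j x = 0.
Proof. by move=> j1; rewrite rN_def // => -[]. Qed.

Lemma S_in_R j x : (1 <= j)%N -> N j.-1 x -> Rg j (S j x).
Proof. by move=> j1 Nx; rewrite rR_def //; exists x. Qed.

Lemma Sbar_split j x : (1 <= j)%N ->
  Sb j x = S j x + \sum_(1 <= a < j) Q a (Sb j x).
Proof.
case: j => [//|[|j]] _; last by rewrite [S _ _]rS_def // subrK.
by rewrite big_geq // addr0 rSbar1 rS1.
Qed.

Lemma S_in_Rc j x : (1 <= j)%N -> Rc j.-1 (S j x).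
Proof.
case: j => [//|j] _.
have -> : S j.+1 x = Sb j.+1 x - \sum_(1 <= a < j.+1) Q a (Sb j.+1 x).
  by rewrite {1}(@Sbar_split j.+1 x isT) addrK.
exact: Q_residual.
Qed.

Lemma R_Nc j y : (1 <= j)%N -> linear (S j) -> Rg j y ->
  exists2 x, Nc j x & S j x = y.
Proof.
move=> j1 lS; rewrite rR_def // => -[x + <-].
have [_ _ _ ->] := @rNc_compl _ _ _ _ D j j1.
move=> -[u Nu [u' Nu' <-]]; exists u => //.
by rewrite (lin_mapD lS) (S_N j1 Nu') addr0.
Qed.

(** [rSinv D j] is unconstrained off R_j, so only its composite [T j] with [Q j] is meaningful on
    all of [Bb]. *)
Lemma T_in j y : (1 <= j)%N -> linear (S j) -> Nc j (T j y).
Proof.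
move=> j1 lS; have [x Nx /= <-] := R_Nc j1 lS (Q_in y j1).
by rewrite rSinv_def.
Qed.

Lemma ST j y : (1 <= j)%N -> linear (S j) -> S j (T j y) = Q j y.
Proof.
move=> j1 lS; have [x Nx /= <-] := R_Nc j1 lS (Q_in y j1).
by rewrite rSinv_def.
Qed.

Lemma T_linear j : (1 <= j)%N -> linear (S j) -> linear (T j).
Proof.
move=> j1 lS a y y' /=.
have [x Nx xE] := R_Nc j1 lS (Q_in y j1).
have [x' Nx' xE'] := R_Nc j1 lS (Q_in y' j1).
rewrite Q_linear // -xE -xE' -lS !rSinv_def //.
by apply: (Nc_subspace j1).2.
Qed.

(** Linearity of Sb, S, E and M is mutually recursive. This lemma and the next take it for Sb and S
    up to column [j] as a hypothesis; strong induction in [Sbar_S_linear] closes the loop. Within a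
    column E is filled from the diagonal upwards, hence the induction on [j - i]. *)
Lemma E_linear_le i j : (1 <= i <= j)%N ->
  (forall v, (1 <= v <= j)%N -> linear (Sb v) /\ linear (S v)) -> linear (E i j).
Proof.
move=> + lS; move: {2}(j - i)%N (leqnn (j - i)) => d.
elim: d i => [|d IH] i jid /andP[i1 ij].
  have -> : i = j by lia.
  apply: (@linear_extP _ _ _ _ id) => // x.
  case: j {lS jid} ij => [|[|j]] ij; [lia | by rewrite rE11 | by rewrite rE_diag].
have [eij|neij] := eqVneq i j; first by apply: IH; lia.
apply: linear_extP => [x|]; first by apply: rE_def; lia.
apply: linear_oppP; apply: (@linear_compP _ _ _ _ (T i)).
  by apply: T_linear => //; apply: (lS i _).2; lia.
apply: linear_sum_natP => v iv; apply: linear_compP; first by apply: (lS v _).1; lia.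
by apply: IH; lia.
Qed.

Lemma M_linear_le i j : (1 <= i <= j)%N ->
  (forall v, (1 <= v <= j)%N -> linear (Sb v) /\ linear (S v)) -> linear (M i j).
Proof.
elim: i j => [//|i IH] j /andP[_ ij] lS.
case: i IH ij => [_|i IH] ij.
  case: j ij lS => [//|[|j]] _ lS.
    by apply: (@linear_extP _ _ _ _ id) => // x; rewrite rM11.
  apply: linear_extP => [x|]; first exact: rM1_def.
  exact: E_linear_le.
apply: linear_extP => [x|]; first exact: rM_def.
apply: linear_sum_natP => v iv; apply: linear_compP.
  by apply: IH => [|w wv]; [lia | apply: lS; lia].
by apply: E_linear_le => //; lia.
Qed.

Lemma Sbar_S_linear j : (1 <= j)%N -> linear (Sb j) /\ linear (S j).
Proof.
elim/ltn_ind: j => -[//|[|j]] IH _.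
  by split; apply: linear_extP (L_linear 0%N) => x; rewrite ?rSbar1 ?rS1.
have lSb : linear (Sb j.+2).
  apply: linear_extP => [x|]; first exact: rSbar_def.
  apply: linear_sum_natP => i ij; apply: linear_compP => //.
  by apply: M_linear_le => [|v vj]; [lia | apply: IH; lia].
split=> //; apply: linear_extP => [x|]; first exact: rS_def.
apply: linear_subP => //; apply: linear_sum_natP => i ij.
by apply: linear_compP => //; apply: Q_linear; lia.
Qed.

Lemma Sbar_linear j : (1 <= j)%N -> linear (Sb j).
Proof. by move=> /Sbar_S_linear []. Qed.

Lemma S_linear j : (1 <= j)%N -> linear (S j).
Proof. by move=> /Sbar_S_linear []. Qed.

Lemma M_linear i j : (1 <= i <= j)%N -> linear (M i j).
Proof. by move=> ij; apply: M_linear_le => // v /andP[v1 _]; exact: Sbar_S_linear. Qed.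

Lemma E_diag j x : (1 <= j)%N -> E j j x = x.
Proof. by case: j => [|[|j]] // _; rewrite ?rE11 ?rE_diag. Qed.

Lemma E_in_Nc i j x : (1 <= i < j)%N -> Nc i (E i j x).
Proof.
move=> ij; rewrite rE_def //; apply: subspaceN; first by apply: Nc_subspace; lia.
by apply: T_in; [lia | apply: S_linear; lia].
Qed.

Lemma M_diag j x : (1 <= j)%N -> M j j x = x.
Proof.
elim: j => [//|[|j] IH] _; first by rewrite rM11.
by rewrite rM_def ?leqnn // big_nat1 E_diag // IH.
Qed.

Lemma M1E j x : (1 <= j)%N -> M 1 j x = E 1 j x.
Proof. by case: j => [|[|j]] // _; rewrite ?rM11 ?rE11 ?rM1_def. Qed.

(** * Conjugation of the Toeplitz operators *)

Lemma Q_Sbar_Nc i b x : (1 <= i <= b)%N -> Nc i x ->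
  Q b (Sb i x) = if b == i then S i x else 0.
Proof.
move=> /andP[i1 ib] Nx; have b1 := leq_trans i1 ib.
rewrite Sbar_split // (lin_mapD (Q_linear b1)) (lin_map_sum (Q_linear b1)).
rewrite (@Q_R b i) //; last by apply: S_in_R => //; apply: Nc_sub.
rewrite big_nat big1 ?addr0 // => a ai.
by rewrite (@Q_R b a); [case: eqP => // ?; lia | lia | lia | apply: Q_in; lia].
Qed.

Lemma Sbar_Nc i j x : (1 <= i < j)%N -> Nc i x ->
  Sb i x = \sum_(1 <= a < j) Q a (Sb i x).
Proof.
move=> ij Nx; rewrite [LHS]Sbar_split; last lia.
rewrite [RHS](@big_cat_nat _ _ _ i) /=; try lia.
rewrite addrC; congr (_ + _); rewrite big_ltn; last lia.
rewrite Q_Sbar_Nc ?eqxx //; last lia.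
rewrite big_nat big1 ?addr0 // => a ai.
by rewrite Q_Sbar_Nc //; [case: eqP => // ?; lia | lia].
Qed.

(** The term v = b contributes, by [ST], minus the R_b component of all later terms; by [Q_Sbar_Nc]
    the earlier terms have no component in R_b. *)
Lemma Q_Sbar_E i j b x : (1 <= i)%N -> (i <= b < j)%N ->
  Q b (\sum_(i <= v < j.+1) Sb v (E v j x)) = 0.
Proof.
move=> + ibj; have ij : (i <= j)%N by lia.
move: {2}(j - i)%N (leqnn (j - i)) => d.
elim: d i ibj ij => [|d IH] i ibj ij jid i1; first by lia.
have b1 : (1 <= b)%N by lia.
rewrite big_ltn; last lia.
rewrite (lin_mapD (Q_linear b1)) Q_Sbar_Nc; [|lia|by apply: E_in_Nc; lia].
case: eqP => [->|nbi]; last by rewrite add0r; apply: IH; lia.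
rewrite rE_def; last lia.
rewrite (lin_mapN (S_linear i1)) (ST _ i1 (S_linear i1)).
by rewrite addNr.
Qed.

(** Apply I - Q_1 - ... - Q_(j-1). It fixes the sum by [Q_Sbar_E], kills each term with v < j, which
    lies in R_1 + ... + R_(j-1), and turns the diagonal term Sb_j x into S_j x. *)
Lemma sum_Sbar_E j x : (1 <= j)%N -> \sum_(1 <= v < j.+1) Sb v (E v j x) = S j x.
Proof.
move=> j1; pose q (y : Bb) := y - \sum_(1 <= a < j) Q a y.
have lq : linear q.
  apply: linear_subP => //; apply: linear_sum_natP => i ij.
  by apply: Q_linear; lia.
set V := LHS; have <- : q V = V.
  rewrite /q big_nat big1 ?subr0 // => b bj; apply: Q_Sbar_E => //.
rewrite /V big_nat_recr //= (lin_mapD lq) (lin_map_sum lq) big_nat big1 ?add0r.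
  by rewrite E_diag // /q {1}Sbar_split // addrK.
move=> v vj; rewrite /q -(Sbar_Nc vj) ?subrr //; exact: E_in_Nc.
Qed.

Lemma exchange_triangle (V : nmodType) (m n : nat) (f : nat -> nat -> V) :
  \sum_(m <= a < n) \sum_(a <= v < n) f a v =
  \sum_(m <= v < n) \sum_(m <= a < v.+1) f a v.
Proof.
elim: n => [|n IH]; first by rewrite !big_geq.
have [mn|nm] := leqP m n; last by rewrite !big_geq.
rewrite [RHS]big_nat_recr //= -IH [in LHS]big_nat_recr //= big_nat1.
rewrite [X in _ = _ + X]big_nat_recr //= addrA; congr (_ + _).
rewrite -big_split /= !big_nat; apply: eq_bigr => a ?.
by rewrite big_nat_recr //=; lia.
Qed.

(* The upper triangular operator matrix M turns the Toeplitz operator of L into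
   that of S. *)
Lemma sum_L_M r c x : (1 <= r <= c)%N ->
  \sum_(r <= a < c.+1) L (a - r) (M a c x) = S (c - r).+1 x.
Proof.
elim: r c x => [//|[|r] IH] c x /andP[_ rc].
  (* First row: after exchanging the sums, the inner sums are the definition of Sb_v, and
     [sum_Sbar_E] applies. *)
  rewrite big_ltn // subnn M1E //.
  have -> : (c - 1).+1 = c by lia.
  rewrite -sum_Sbar_E // [RHS]big_ltn //; congr (_ + _); first by rewrite rSbar1.
  under eq_big_nat => a ac.
    rewrite rM_def; last lia.
    rewrite (lin_map_sum (L_linear _)); over.
  rewrite exchange_triangle; apply: eq_big_nat => v vc.
  rewrite rSbar_def; last lia.
  by rewrite big_add1 /=; apply: eq_big_nat => a av; rewrite subn1.
under eq_big_nat => a ac.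
  rewrite rM_def; last lia.
  rewrite (lin_map_sum (L_linear _)); over.
rewrite exchange_triangle.
under eq_big_nat => v vc.
  rewrite big_add1 /=.
  have vE : v = v.-1.+1 by lia.
  rewrite [X in \sum_(_ <= _ < X) _]vE.
  under eq_big_nat => a av do rewrite subSS.
  rewrite IH; last lia.
  have -> : (v.-1 - r.+1 = v - r.+2)%N by lia.
  over.
rewrite big_nat_recr //= E_diag; last lia.
rewrite big_nat big1 ?add0r // => v vc.
(* E_(v,c) takes values in N_v^c, a subspace of N_(v-1), while the index of S here is at most v -
   1. *)
apply: S_N => //; apply: (@N_decr _ v.-1); first lia.
by apply: Nc_sub; [lia | apply: E_in_Nc; lia].
Qed.

(** * Root chains *)

Definition residual (b : nat -> B) (m : nat) : Bb :=
  \sum_(0 <= a < m.+1) L a (b (m - a)%N).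

(** [residual b m] is the coefficient of eps^m in L(eps) b(eps). The tuple is stored in reverse
    order, so row [i] of the Toeplitz operator is the coefficient of index k - 1 - i. *)
Lemma toeplitz_residual k (b : nat -> B) (i : 'I_k) :
  toeplitz L (fun j : 'I_k => b (k.-1 - j)%N) i = residual b (k.-1 - i)%N.
Proof.
have ik := ltn_ord i; rewrite /toeplitz /residual.
rewrite -(big_geq_mkord i k xpredT (fun j => L (j - i) (b (k.-1 - j)%N))).
rewrite -{1}[i : nat]add0n big_addn.
have -> : (k - i = (k.-1 - i).+1)%N by lia.
apply: eq_big_nat => a ak; congr (L _ (b _)); lia.
Qed.

Lemma root_chainP k b0 : root_chain L k b0 <->
  exists2 b : nat -> B, b 0%N = b0 & forall m, (m < k)%N -> residual b m = 0.
Proof.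
split=> -[b bb0 h]; exists b => //.
  move=> m mk; have i_k : (k.-1 - m < k)%N by lia.
  have := h (Ordinal i_k); rewrite toeplitz_residual /=.
  by have -> : (k.-1 - (k.-1 - m) = m)%N by lia.
by move=> i; rewrite toeplitz_residual; apply: h; have := ltn_ord i; lia.
Qed.

(** Read from the diagonal upwards, column [n] of M is a family b(eps) starting at [x] whose image
    under L agrees with S(eps) x in the first [n] coefficients. *)
Lemma residual_M n l x : (l < n)%N -> residual (fun a => M (n - a) n x) l = S l.+1 x.
Proof.
move=> ln; have /(_ _) := @sum_L_M (n - l) n x.
have -> : (n - (n - l)).+1 = l.+1 by lia.
move=> <-; last lia.
rewrite -[X in _ = \sum_(X <= _ < _) _]add0n big_addn /residual.
have -> : (n.+1 - (n - l) = l.+1)%N by lia.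
apply: eq_big_nat => a al.
have -> : (n - (l - a) = a + (n - l))%N by lia.
by rewrite addnK.
Qed.

Lemma residualB b b' m :
  residual (fun a => b a - b' a) m = residual b m - residual b' m.
Proof.
rewrite /residual -sumrB; apply: eq_bigr => a _; exact: (lin_mapB (L_linear _)).
Qed.

Lemma residual_shift b m : b 0%N = 0 ->
  residual (fun a => b a.+1) m = residual b m.+1.
Proof.
move=> b0; rewrite /residual [RHS]big_nat_recr //= subnn b0.
rewrite (lin_map0 (L_linear _)) addr0; apply: eq_big_nat => a am.
by rewrite subSn //; lia.
Qed.

Definition in_sumR (j : nat) (y : Bb) : Prop := y = \sum_(1 <= a < j.+1) Q a y.

Lemma in_sumR_piece i j y : (1 <= i <= j)%N -> Rg i y -> in_sumR j y.
Proof.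
move=> ij Ry; rewrite /in_sumR (bigD1_seq i) ?iota_uniq ?mem_index_iota //=.
rewrite (@Q_R i i) ?eqxx //; try lia.
rewrite big_nat_cond big1 ?addr0 // => a /andP[aj /negPf ai].
by rewrite (@Q_R a i) ?ai //; lia.
Qed.

Lemma in_sumRD j y y' : in_sumR j y -> in_sumR j y' -> in_sumR j (y + y').
Proof.
move=> jy jy'; rewrite /in_sumR {1}jy {1}jy' -big_split /=.
by apply: eq_big_nat => a aj; rewrite (lin_mapD (Q_linear _)) //; lia.
Qed.

Lemma in_sumR_le i j y : (i <= j)%N -> in_sumR i y -> in_sumR j y.
Proof.
move=> ij iy; rewrite /in_sumR (@big_cat_nat _ _ _ i.+1) //= -iy.
rewrite big_nat big1 ?addr0 // => a aj.
have a1 : (1 <= a)%N by lia.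
rewrite iy (lin_map_sum (Q_linear a1)) big_nat big1 // => b bi.
rewrite (@Q_R a b) //; [case: eqP => //| | apply: Q_in]; lia.
Qed.

(* Subtracting from a root chain the chain [M_(n - a) n b_0] makes it start with
   0, hence a shifted root chain which is shorter. *)
Lemma chain_in_N m b : (forall l, (l < m)%N -> residual b l = 0) ->
  N m (b 0%N) /\ in_sumR m.+1 (residual b m).
Proof.
elim/ltn_ind: m b => -[_|m IH] b hb.
  split; first by rewrite rN0.
  apply: (@in_sumR_piece 1) => //.
  rewrite /residual big_nat1 subnn -(rS1 D); apply: S_in_R => //=.
  by rewrite rN0.
pose b' a := b a.+1 - M (m.+2 - a.+1) m.+2 (b 0%N).
have resb' l : (l <= m)%N -> residual b' l = residual b l.+1 - S l.+2 (b 0%N).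
  move=> lm; rewrite -(@residual_M m.+2) // -residualB -residual_shift //=.
  by rewrite subn0 M_diag // subrr.
have [Nm _] := IH m (ltnSn m) b (fun l lm => hb l (ltnW lm)).
(* The second conclusion carries the induction: for m > 0, applied to the shifted chain, it puts
   S_(m+1) b_0 into R_1 + ... + R_m, whereas S_(m+1) maps into R_m^c. *)
have Sm : S m.+1 (b 0%N) = 0.
  case: m @b' IH hb resb' Nm => [|m] b' IH hb resb' Nm.
    by have := hb 0%N isT; rewrite /residual big_nat1 rS1.
  have [l lm|_] := IH m (leqnSn _) b'.
     rewrite resb' ?hb ?sub0r; try lia.
    by rewrite (@S_N l.+2) ?oppr0 //; apply: N_decr Nm; lia.
  rewrite resb' // hb // sub0r /in_sumR big_nat big1 => [/eqP|].
    by rewrite oppr_eq0 => /eqP.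
  move=> a am; have a1 : (1 <= a)%N by lia.
  rewrite (lin_mapN (Q_linear a1)) (@Q_Rc a m.+1) ?oppr0 //.
  exact: (@S_in_Rc m.+2).
have Nm1 : N m.+1 (b 0%N) by rewrite rN_def.
split=> //; have [l lm|_] := IH m (ltnSn m) b'.
  rewrite resb' ?hb ?sub0r; try lia.
  by rewrite (@S_N l.+2) ?oppr0 //; apply: N_decr Nm1; lia.
rewrite resb' // => h; rewrite -[residual b m.+1](subrK (S m.+2 (b 0%N))).
apply: in_sumRD; first by apply: in_sumR_le h.
by apply: (@in_sumR_piece m.+2); [lia | apply: S_in_R].
Qed.

(** For the converse, column [j] of M provides a chain: its residuals are S_1 b, ..., S_j b, all
    zero on N_j. *)
Lemma root_chain_N j b : root_chain L j b <-> N j b.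
Proof.
split=> [/root_chainP[c <- hc]|Nb]; first by apply: (chain_in_N hc).1.
apply/root_chainP; case: j Nb => [|j] Nb; first by exists (fun=> b).
exists (fun a => M (j.+1 - a) j.+1 b); first by rewrite subn0 M_diag.
move=> m mj; rewrite residual_M //; apply: S_N => //; apply: N_decr Nb; lia.
Qed.

(** * Rank and stabilization *)

Section Rank.
Variable R : realType.

Lemma kernel_L0 b : op_kernel (L 0%N) b <-> N 1 b.
Proof. by rewrite rN_def //= rN0 /op_kernel /= rS1; split=> [|[]]. Qed.

Lemma rank_ge j b : (1 <= j)%N -> N j b -> (j%:R%:E <= rank L R b)%E.
Proof.
move=> j1 Nb; rewrite /rank asboolT; last by apply/kernel_L0; apply: N_decr Nb.
by apply: ereal_sup_ubound; exists j => //; split=> //; apply/root_chain_N.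
Qed.

Lemma rank_le j b : ~ N j.+1 b -> (rank L R b <= j%:R%:E)%E.
Proof.
move=> Nb; rewrite /rank; case: asboolP => _; last by rewrite lee_fin.
apply: ge_ereal_sup => _ [i [i1 /root_chain_N Ni] <-].
rewrite lee_fin ler_nat leqNgt; apply/negP => ji; apply: Nb; exact: N_decr Ni.
Qed.

(** A point of N_(k+1) has rank above k, and stabilization then leaves only infinite rank. *)
Lemma stabilizes_N k : stabilizes L R k -> forall x j, N k.+1 x -> N j x.
Proof.
move=> [h _] x j Nx; have := rank_ge (ltn0Sn k) Nx.
have [[m mk ->]|roo _] := h x.
  by rewrite lee_fin ler_nat ltnNge mk.
case: j => [|j]; first by rewrite rN0.
by apply: contrapT => /rank_le; rewrite roo leye_eq.
Qed.

(** A point of rank exactly k lies in N_k but not in N_(k+1). This is what later makes the leading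
    coefficient of the pole of order k nonzero. *)
Lemma stabilizes_Nc k : stabilizes L R k -> exists2 x, Nc k.+1 x & x != 0.
Proof.
move=> [_ [b rb]].
have Nk : N k b.
  case: k rb => [|k] rb; first by rewrite rN0.
  apply: contrapT => /rank_le; rewrite rb lee_fin ler_nat ltnn //.
have NNk : ~ N k.+1 b.
  by move=> /(rank_ge (ltn0Sn k)); rewrite rb lee_fin ler_nat ltnn.
have [_ _ _ NE] := @rNc_compl _ _ _ _ D k.+1 isT.
move: Nk; rewrite -[k]/(k.+1.-1) NE => -[u Nu [u' Nu' ub]].
exists u => //; apply/eqP => u0; apply: NNk.
by rewrite -ub u0 add0r.
Qed.

End Rank.

(** * Consequences of stabilization *)

Section Stabilized.
Variable k : nat.
Hypothesis N_stab : forall x j, N k.+1 x -> N j x.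

Lemma S_N_stab j x : (1 <= j)%N -> N k.+1 x -> S j x = 0.
Proof. by move=> j1 Nx; apply: S_N => //; apply: N_stab. Qed.

(** For j >= k + 2 the spaces N_(j-1) and N_j agree, so the complement is trivial. The vanishing of
    T_j, of Q_j and of the off-diagonal E_(j,c) follows from this. *)
Lemma Nc_stab j x : (k.+2 <= j)%N -> Nc j x -> x = 0.
Proof.
move=> kj Nx; have j1 : (1 <= j)%N by lia.
have [_ _ I0 _] := @rNc_compl _ _ _ _ D j j1.
have : (Nc j `&` N j) x.
  by split=> //; apply: N_stab; apply: (@N_decr _ j.-1); [lia | apply: Nc_sub].
by rewrite I0.
Qed.

Lemma T_stab j y : (k.+2 <= j)%N -> T j y = 0.
Proof. by move=> kj; apply: (Nc_stab kj); apply: T_in; [|apply: S_linear]; lia. Qed.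

Lemma Q_stab j y : (k.+2 <= j)%N -> Q j y = 0.
Proof.
move=> kj; have j1 : (1 <= j)%N by lia.
rewrite -(ST y j1 (S_linear j1)) (T_stab y kj).
exact: (lin_map0 (S_linear j1)).
Qed.

Lemma E_stab i j x : (k.+2 <= i < j)%N -> E i j x = 0.
Proof. by move=> ij; apply: (@Nc_stab i); [|apply: E_in_Nc]; lia. Qed.

(** Only the diagonal term v = j of the defining sum survives. This is the Toeplitz property of
    M. *)
Lemma M_stab i j x : (k.+2 <= i <= j)%N -> M i j x = M i.-1 j.-1 x.
Proof.
move=> ij; rewrite rM_def; last lia.
rewrite big_nat_recr /=; last lia.
rewrite E_diag; last lia.
rewrite big_nat big1 ?add0r // => v vj; rewrite E_stab; last lia.
apply: lin_map0; apply: M_linear; lia.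
Qed.

Lemma M_shift d m x : M (k.+1 + d) (k.+1 + d + m) x = M k.+1 (k.+1 + m) x.
Proof.
elim: d => [|d <-]; first by rewrite addn0.
rewrite M_stab; last lia.
by congr (M _ _ x); lia.
Qed.

(** Row k + 1 of the conjugation formula, whose entries of M are moved back to row k + 1 by
    [M_shift]. *)
Lemma L_phi m x : \sum_(0 <= i < m.+1) L i (M k.+1 (k.+1 + (m - i)) x) = S m.+1 x.
Proof.
have /(_ _) := @sum_L_M k.+1 (k.+1 + m) x.
rewrite addKn => <-; last lia.
rewrite -[X in _ = \sum_(X <= _ < _) _]add0n big_addn.
have -> : ((k.+1 + m).+1 - k.+1 = m.+1)%N by lia.
apply: eq_big_nat => a am; rewrite addnK -(@M_shift a); congr (L _ (M _ _ _)); lia.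
Qed.

Lemma S_sumP j x : (1 <= j)%N -> S j x = \sum_(1 <= i < k.+2) S j (P i x).
Proof.
move=> j1; have := S_N_stab j1 (P_residual k.+1 x).
rewrite (lin_mapB (S_linear j1)) (lin_map_sum (S_linear j1)) => /eqP.
by rewrite subr_eq0 => /eqP.
Qed.

Lemma S_P0 i j x : (1 <= j < i)%N -> S j (P i x) = 0.
Proof.
move=> ji; apply: S_N; first lia.
apply: (@N_decr _ i.-1); first lia.
by apply: Nc_sub; [|apply: P_in]; lia.
Qed.

(** S_j x lies in R_j, so only a = j contributes, and there T_j undoes S_j. This explains the
    formula for the coefficients of psi. *)
Lemma psi_S i j x : (1 <= j <= k.+1)%N -> Nc j x ->
  \sum_(1 <= a < k.+2) S (i + a) (T a (S j x)) = S (i + j) x.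
Proof.
move=> jk Nx; have j1 : (1 <= j)%N by lia.
have RS : Rg j (S j x) by apply: S_in_R => //; apply: Nc_sub.
rewrite (bigD1_seq j) ?iota_uniq ?mem_index_iota //=.
rewrite (@Q_R j j) // eqxx rSinv_def // big_nat_cond big1 ?addr0 //.
move=> a /andP[ak /negPf aj]; have a1 : (1 <= a)%N by lia.
have := lin_map0 (T_linear a1 (S_linear a1)).
rewrite /= (lin_map0 (Q_linear a1)) => T0.
rewrite (@Q_R a j) // aj T0.
by apply: lin_map0; apply: S_linear; lia.
Qed.

End Stabilized.

End Recursion.

(** * Real-valued norms *)

(* Both R and R[i] are such fields K; their norms, which Rocq sees as elements
   of K, can then be handled as real numbers. *)
Record real_scalars (R : realType) (K : numFieldType) := RealScalars {
  toK : {rmorphism R -> K};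
  ofK : K -> R;
  toK_le : forall x y, (toK x <= toK y) = (x <= y);
  ofK_K : forall x, 0 <= x -> toK (ofK x) = x }.

Lemma real_scalars_real (R : realType) : real_scalars R R.
Proof. by exists (idfun : {rmorphism R -> R}) id. Qed.

Lemma real_scalars_complex (R : realType) : real_scalars R R[i].
Proof.
exists (real_complex R : {rmorphism R -> R[i]}) (@complex.Re R) => [x y|].
  by rewrite lecR.
by case=> a b; rewrite lecE /= => /andP[/eqP -> _].
Qed.

Section RealNorm.
Context {R : realType} {K : numFieldType} {rs : real_scalars R K}.

Definition rn (V : normedZmodType K) (x : V) : R := ofK rs `|x|.

Section Basic.
Variables (V : normedZmodType K).
Implicit Types x y : V.

Lemma toK_rn x : toK rs (rn x) = `|x|.
Proof. by rewrite /rn ofK_K. Qed.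

Lemma toK_lt a b : (toK rs a < toK rs b) = (a < b).
Proof. by rewrite !lt_neqAle toK_le (inj_eq (fmorph_inj _)). Qed.

Lemma toK_ge0 a : (0 <= toK rs a) = (0 <= a).
Proof. by rewrite -(rmorph0 (toK rs)) toK_le. Qed.

Lemma toK_gt0 a : (0 < toK rs a) = (0 < a).
Proof. by rewrite -(rmorph0 (toK rs)) toK_lt. Qed.

Lemma rn_ge0 x : 0 <= rn x.
Proof. by rewrite -toK_ge0 toK_rn. Qed.

Lemma rn_leP x a : (`|x| <= toK rs a) = (rn x <= a).
Proof. by rewrite -toK_rn toK_le. Qed.

Lemma rn_ltP x a : (`|x| < toK rs a) = (rn x < a).
Proof. by rewrite -toK_rn toK_lt. Qed.

Lemma rnD x y : rn (x + y) <= rn x + rn y.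
Proof. by rewrite -rn_leP rmorphD /= !toK_rn ler_normD. Qed.

Lemma rnN x : rn (- x) = rn x.
Proof. by rewrite /rn normrN. Qed.

Lemma rnB x y : rn (x - y) <= rn x + rn y.
Proof. by rewrite -[rn y]rnN rnD. Qed.

Lemma rn_distC x y : rn (x - y) = rn (y - x).
Proof. by rewrite -rnN opprB. Qed.

Lemma rn0 : rn (0 : V) = 0.
Proof. by apply: (fmorph_inj (toK rs)); rewrite toK_rn normr0 rmorph0. Qed.

Lemma rn_eq0 x : (rn x == 0) = (x == 0).
Proof.
by rewrite -(inj_eq (fmorph_inj (toK rs))) rmorph0 toK_rn normr_eq0.
Qed.

Lemma rn_sum (m n : nat) (u : nat -> V) :
  rn (\sum_(m <= i < n) u i) <= \sum_(m <= i < n) rn (u i).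
Proof.
elim/big_ind2 : _ => [|x a y b xa yb|//]; first by rewrite rn0.
exact: le_trans (rnD _ _) (lerD xa yb).
Qed.

Lemma rn_sum_le (m n : nat) (u : nat -> V) (a : nat -> R) :
  (forall i, (m <= i < n)%N -> rn (u i) <= a i) ->
  rn (\sum_(m <= i < n) u i) <= \sum_(m <= i < n) a i.
Proof. by move=> ua; apply: le_trans (rn_sum _ _ _) _; apply: ler_sum_nat. Qed.

End Basic.

Lemma rnZ (V : normedModType K) (a : K) (x : V) : rn (a *: x) = rn a * rn x.
Proof. by apply: (fmorph_inj (toK rs)); rewrite rmorphM /= !toK_rn normrZ. Qed.

Lemma rnM (a b : K) : rn (a * b) = rn a * rn b.
Proof. by apply: (fmorph_inj (toK rs)); rewrite rmorphM /= !toK_rn normrM. Qed.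

Lemma rn1 : rn (1 : K) = 1.
Proof. by apply: (fmorph_inj (toK rs)); rewrite toK_rn normr1 rmorph1. Qed.

Lemma rnX (a : K) n : rn (a ^+ n) = rn a ^+ n.
Proof. by elim: n => [|n IH]; rewrite ?expr0 ?rn1 // !exprS rnM IH. Qed.

Lemma rn_nat n : rn (n%:R : K) = n%:R.
Proof. by apply: (fmorph_inj (toK rs)); rewrite toK_rn normr_nat rmorph_nat. Qed.

Lemma rn_toK a : 0 <= a -> rn (toK rs a) = a.
Proof. by move=> a0; apply: (fmorph_inj (toK rs)); rewrite toK_rn ger0_norm ?toK_ge0. Qed.

Lemma rnV (a : K) : rn a^-1 = (rn a)^-1.
Proof. by apply: (fmorph_inj (toK rs)); rewrite fmorphV /= !toK_rn normfV. Qed.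

Lemma exists_expr2_lt (a e : R) : 0 < e ->
  exists N, forall n, (N <= n)%N -> a * 2^-1 ^+ n <= e.
Proof.
move=> e0; exists (Num.truncn (`|a| / e)).+1 => n Nn.
have a_n : `|a| / e <= n%:R.
  by apply: le_trans (ltW (truncnS_gt _)) _; rewrite ler_nat.
rewrite exprVn ler_pdivrMr ?exprn_gt0 //.
apply: le_trans (ler_norm _) _.
rewrite mulrC -ler_pdivrMr //; apply: le_trans a_n _.
by rewrite -natrX ler_nat; apply: ltnW; apply: ltn_expl.
Qed.

Lemma near_rnP (P : K -> Prop) (z0 : K) : (\forall z \near z0, P z) <->
  exists2 d : R, 0 < d & forall z, rn (z - z0) < d -> P z.
Proof.
split=> [/nbhs_ballP[e /= e0 eP]|[d d0 dP]].
  have eE := ofK_K rs (ltW e0); exists (ofK rs e).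
    by rewrite -toK_gt0 eE.
  move=> z zd; apply: eP; rewrite -ball_normE /= distrC.
  by rewrite -eE rn_ltP.
apply/nbhs_ballP; exists (toK rs d); first by rewrite /= toK_gt0.
by move=> z; rewrite -ball_normE /= distrC rn_ltP => /dP.
Qed.

Lemma open_disc (d : R) : open [set z : K | rn z < d].
Proof.
rewrite openE => z /= zd; apply/near_rnP; exists (d - rn z); first by rewrite subr_gt0.
move=> w wz /=; rewrite -[w](subrK z); apply: le_lt_trans (rnD _ _) _.
by rewrite -ltrBrDr.
Qed.

Section Convergence.
Variables (V : normedModType K).

Lemma cvg_rnP (u : nat -> V) (l : V) : u @ \oo --> l <->
  forall e : R, 0 < e -> exists N, forall n, (N <= n)%N -> rn (l - u n) <= e.
Proof.
split=> [/cvgrPdist_le ul e e0|ul].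
  have [|N _ hN] := ul (toK rs e); first by rewrite toK_gt0.
  by exists N => n Nn; rewrite -rn_leP; apply: hN.
apply/cvgrPdist_le => e e0; have eE := ofK_K rs (ltW e0).
have [|N hN] := ul (ofK rs e); first by rewrite -toK_gt0 eE.
by exists N => // n /= Nn; rewrite -eE rn_leP; apply: hN.
Qed.

Lemma rn_le_eps (x : V) (a : R) : (forall e, 0 < e -> rn x <= a + e) -> rn x <= a.
Proof. by move=> h; apply/ler_addgt0Pr. Qed.

End Convergence.

Lemma geometric_dist (V : normedZmodType K) (u : nat -> V) (c q : R) :
  0 <= c -> 0 <= q <= 2^-1 ->
  (forall n, rn (u n.+1 - u n) <= c * q ^+ n) ->
  forall n m, (n <= m)%N -> rn (u m - u n) <= 2 * c * q ^+ n.
Proof.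
move=> c0 /andP[q0 q1] hu n m nm.
(* The stronger bound with q^n - q^m makes the induction on [m] close; the slack in each step is w
   (1 - 2 q), nonnegative because q <= 1/2. *)
suff : rn (u m - u n) <= 2 * c * (q ^+ n - q ^+ m).
  move=> h; apply: le_trans h _; rewrite ler_wpM2l //; first lra.
  by rewrite gerBl exprn_ge0.
elim: m nm => [|m IH].
  by rewrite leqn0 => /eqP ->; rewrite !subrr rn0 mulr0.
rewrite leq_eqVlt => /orP[/eqP ->|]; first by rewrite !subrr rn0 mulr0.
rewrite ltnS => /IH {}IH.
rewrite -(subrKA (u m)); apply: le_trans (rnD _ _) _.
have := hu m; have qm : 0 <= q ^+ m by rewrite exprn_ge0.
rewrite exprS.
have : 0 <= c * q ^+ m by rewrite mulr_ge0.
set w := c * q ^+ m => w0 hm.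
have : 0 <= w * (1 - 2 * q) by rewrite mulr_ge0 //; lra.
have -> : 2 * c * (q ^+ n - q * q ^+ m) = 2 * c * (q ^+ n - q ^+ m) + w + w * (1 - 2 * q).
  by rewrite /w; ring.
lra.
Qed.

(* Completeness enters only here. *)
Lemma geometric_cvg (V : completeNormedModType K) (u : nat -> V) (c q : R) :
  0 <= c -> 0 <= q <= 2^-1 ->
  (forall n, rn (u n.+1 - u n) <= c * q ^+ n) ->
  exists2 l, u @ \oo --> l & forall n, rn (l - u n) <= 2 * c * q ^+ n.
Proof.
move=> c0 q01 hu; have du := geometric_dist c0 q01 hu.
have cu : cvgn u.
  apply: cauchy_cvg; apply: cauchy_exP => e e0.
  have eE := ofK_K rs (ltW e0).
  have e0' : 0 < ofK rs e / 2.
    by apply: divr_gt0 => //; rewrite -toK_gt0 eE.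
  have [n hn] := exists_expr2_lt (2 * c) e0'.
  exists (u n); exists n => // m /= nm.
  rewrite -ball_normE /= -eE rn_ltP rn_distC.
  apply: le_lt_trans (du _ _ nm) _.
  apply: (@le_lt_trans _ _ (ofK rs e / 2)); last by lra.
  apply: le_trans (hn n (leqnn n)); rewrite ler_wpM2l //; first by lra.
  by rewrite lerXn2r ?nnegrE ?invr_ge0 //; case/andP: q01.
exists (limn u) => // n; apply: rn_le_eps => e e0.
have /cvg_rnP /(_ e e0)[N hN] := cu.
rewrite -(subrKA (u (N + n)%N)) addrC; apply: le_trans (rnD _ _) _.
by apply: lerD; [apply: du; rewrite leq_addl | apply: hN; rewrite leq_addr].
Qed.

(** * Bounded operators and the closed graph theorem *)

Definition op_le (V W : normedModType K) (c : R) (T : V -> W) : Prop :=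
  forall x, rn (T x) <= c * rn x.

Lemma bounded_opP (V W : normedModType K) (T : V -> W) : bounded_op T <->
  linear T /\ exists2 c, 0 <= c & op_le c T.
Proof.
split=> -[lT].
  pose f := HB.pack_for {linear V -> W} T (GRing.isLinear.Build _ _ _ _ T lT).
  move=> cT; split=> //.
  have /linear_boundedP : bounded_near f (nbhs 0) by apply/linear_bounded_continuous.
  move=> /pinfty_ex_gt0[r r0 hr]; have rE := ofK_K rs (ltW r0).
  exists (ofK rs r); first by rewrite -toK_ge0 rE ltW.
  by move=> x; rewrite -(toK_le rs) rmorphM /= !toK_rn rE; apply: hr.
move=> [c c0 hT]; split=> // x.
pose f := HB.pack_for {linear V -> W} T (GRing.isLinear.Build _ _ _ _ T lT).
apply: (@bounded_linear_continuous _ _ _ f); apply/linear_boundedP.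
exists (toK rs c); split; first by rewrite ger0_real // toK_ge0.
move=> r cr y; apply: le_trans (_ : toK rs c * `|y| <= _).
  by rewrite -!toK_rn -rmorphM toK_le; apply: hT.
by rewrite ler_wpM2r // ltW.
Qed.

(** Baire's theorem: some A_n is dense in a ball. Otherwise there are shrinking balls, each chosen
    away from the next A_n, whose centres converge to a point outside every A_n. *)
Lemma baire_cover (V : completeNormedModType K) (A : nat -> set V) :
  (forall x, exists n, A n x) ->
  exists n y0 (d : R), 0 < d /\ forall y, rn (y - y0) < d ->
    forall e : R, 0 < e -> exists2 a, A n a & rn (y - a) < e.
Proof.
move=> cA; apply: contrapT => nA.
(* The positivity of the old radius is assumed after the existential, so that [choice] yields a
   total function. The factor 2 in the last clause keeps the limit, which is within one radius of
   the centre, off A_n. *)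
have step (s : nat * (V * R)) : exists t : V * R, 0 < s.2.2 ->
    [/\ rn (t.1 - s.2.1) <= s.2.2 / 2, 0 < t.2, t.2 <= s.2.2 / 2 &
        forall a, A s.1 a -> 2 * t.2 <= rn (t.1 - a)].
  case: s => n [y d] /=; apply: contrapT => nt; apply: nA.
  have d0 : 0 < d by apply: contrapT => nd; apply: nt; exists (y, d).
  exists n, y, (d / 2); split; first lra.
  move=> y' y'd e e0; apply: contrapT => na; apply: nt.
  exists (y', Num.min (d / 2) (e / 2)) => _ /=; split.
  - exact: ltW.
  - by rewrite lt_min; apply/andP; split; lra.
  - by rewrite ge_min lexx.
  - move=> a Aa; have : Num.min (d / 2) (e / 2) <= e / 2 by rewrite ge_min lexx orbT.
    suff : e <= rn (y' - a) by lra.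
    by rewrite leNgt; apply/negP => ya; apply: na; exists a.
have [f hf] := choice step.
pose fix s n := if n is m.+1 then f (m, s m) else (0 : V, 1 : R).
pose y n := (s n).1; pose d n := (s n).2.
have d_gt0 n : 0 < d n.
  elim: n => [|n IH]; first by rewrite /d /= ltr01.
  by have [] := hf (n, s n) IH.
have hs n : [/\ rn (y n.+1 - y n) <= d n / 2, d n.+1 <= d n / 2 &
    forall a, A n a -> 2 * d n.+1 <= rn (y n.+1 - a)].
  by have [] := hf (n, s n) (d_gt0 n).
have d_le n : d n <= 2^-1 ^+ n.
  elim: n => [|n IH]; first by rewrite expr0.
  by have [_ h _] := hs n; rewrite exprS; lra.
have yd n m : (n <= m)%N -> rn (y m - y n) <= d n - d m.
  elim: m => [|m IH]; first by rewrite leqn0 => /eqP ->; rewrite !subrr rn0.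
  rewrite leq_eqVlt => /orP[/eqP ->|]; first by rewrite !subrr rn0.
  rewrite ltnS => /IH {}IH; rewrite -(subrKA (y m)).
  apply: le_trans (rnD _ _) _; have [h1 h2 _] := hs m; lra.
have h01 : 0 <= (2^-1 : R) <= 2^-1 by lra.
have [|l yl _] := @geometric_cvg _ y 1 _ ler01 h01.
  by move=> n; have [h _ _] := hs n; have := d_le n; have := d_gt0 n; lra.
have ld n : rn (l - y n) <= d n.
  apply: rn_le_eps => e e0.
  have /cvg_rnP /(_ e e0)[N hN] := yl.
  rewrite -(subrKA (y (N + n)%N)); apply: le_trans (rnD _ _) _.
  have := hN _ (leq_addr n N); have := yd _ _ (leq_addl N n).
  have := d_gt0 (N + n)%N; lra.
have [n An] := cA l; have [_ _ /(_ _ An)] := hs n.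
by rewrite rn_distC; have := ld n.+1; have := d_gt0 n.+1; lra.
Qed.

(** By Baire the points with |G a| <= n are dense in some ball. Differences and scaling then
    approximate every y up to half its norm by some a with |G a| <= c |y|; iterating on the error
    gives a geometric series, and closedness identifies its limit as G y. *)
Lemma closed_graph (V W : completeNormedModType K) (G : V -> W) : linear G ->
  (forall (u : nat -> V) x y, u @ \oo --> x -> (fun n => G (u n)) @ \oo --> y ->
     y = G x) ->
  exists2 c, 0 <= c & op_le c G.
Proof.
move=> lG clG.
have [x|n [y0 [d [d0 hd]]]] := @baire_cover V (fun n => [set x | rn (G x) <= n%:R]).
  by exists (Num.truncn (rn (G x))).+1 => /=; rewrite ltW // truncnS_gt.
(* The bound 2 n for vectors of norm d / 2, scaled by 2 |y| / d. *)
pose c : R := 4 * n%:R / d.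
have c0 : 0 <= c by rewrite /c divr_ge0 ?mulr_ge0 // ltW.
have near0 y e : rn y < d -> 0 < e ->
    exists2 a, rn (G a) <= 2 * n%:R & rn (y - a) < e.
  move=> yd e0; have e2 : 0 < e / 2 by lra.
  have [|a1 /= Ga1 ha1] := hd (y0 + y) _ _ e2; first by rewrite addrC addKr.
  have [|a2 /= Ga2 ha2] := hd y0 _ _ e2; first by rewrite subrr rn0.
  exists (a1 - a2).
    rewrite (lin_mapB lG); apply: le_trans (rnB _ _) _; lra.
  have -> : y - (a1 - a2) = (y0 + y - a1) - (y0 - a2).
    by rewrite !opprB [RHS]addrC !addrA subrK [y + a2]addrC.
  apply: le_lt_trans (rnB _ _) _; lra.
have approx y : exists a, rn (y - a) <= rn y / 2 /\ rn (G a) <= c * rn y.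
  have [->|y_neq0] := eqVneq y 0.
    by exists 0; rewrite subrr (lin_map0 lG) !rn0 mulr0 mul0r.
  have ry : 0 < rn y by rewrite lt_neqAle eq_sym rn_eq0 y_neq0 rn_ge0.
  pose t : R := d / (2 * rn y).
  have t0 : 0 < t by rewrite /t divr_gt0 //; lra.
  pose tK := toK rs t.
  have tK0 : tK != 0 by rewrite /tK fmorph_eq0 gt_eqF.
  have rtK : rn tK = t by rewrite rn_toK // ltW.
  have [||a Ga ha] := @near0 (tK *: y) (t * (rn y / 2)).
  - rewrite rnZ rtK /t invfM mulrA divfK ?gt_eqF //; lra.
  - by rewrite mulr_gt0 //; lra.
  exists (tK^-1 *: a); split.
    rewrite -(ler_pM2l t0) -{1}rtK -rnZ scalerBr scalerA divff // scale1r.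
    exact: ltW.
  rewrite (lin_mapZ lG) rnZ rnV rtK mulrC ler_pdivrMr //.
  apply: le_trans Ga _; rewrite /c /t.
  have -> : 4 * n%:R / d * rn y * (d / (2 * rn y)) = 2 * n%:R; last by [].
  by field; rewrite !gt_eqF.
have [g hg] := choice approx.
exists (2 * c); first lra.
(* [r m] is the error left after [m] corrections; its norm at least halves each time. *)
move=> y; pose fix r n := if n is m.+1 then r m - g (r m) else y.
have rr m : rn (r m) <= rn y * 2^-1 ^+ m.
  elim: m => [|m IH]; first by rewrite expr0 mulr1.
  by have [h _] := hg (r m); rewrite /= exprS mulrCA; lra.
have h01 : 0 <= (2^-1 : R) <= 2^-1 by lra.
have cy0 : 0 <= c * rn y by rewrite mulr_ge0 // rn_ge0.
have [|w uw hw] := @geometric_cvg _ (fun m => G (y - r m)) (c * rn y) _ cy0 h01.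
  move=> m; rewrite -(lin_mapB lG) /=.
  rewrite (_ : _ - _ - _ = g (r m)); last first.
    by rewrite !opprB [y + _]addrC addrACA subrK subrr addr0.
  have [_ h] := hg (r m); apply: le_trans h _.
  by rewrite -mulrA ler_wpM2l.
have wy : w = G y.
  apply: clG uw; apply/cvg_rnP => e e0.
  have [N hN] := exists_expr2_lt (rn y) e0.
  exists N => m Nm; rewrite opprB addrC subrK.
  exact: le_trans (rr m) (hN m Nm).
have := hw 0%N; rewrite /= subrr (lin_map0 lG) subr0 expr0 mulr1 wy.
by rewrite mulrA.
Qed.

(** * Power series of operators *)

Definition psum (V W : normedModType K) (A : nat -> V -> W) (h : K) (n : nat)
    (x : V) : W :=
  \sum_(0 <= i < n) h ^+ i *: A i x.

Definition geo_le (V W : normedModType K) (c r : R) (A : nat -> V -> W) : Prop :=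
  forall i, op_le (c * r ^+ i) (A i).

Section OpSum.
Variables (V W : normedModType K) (A : nat -> V -> W) (h : K).
Implicit Types T : V -> W.

Lemma op_sumP T : op_sum (fun i => h ^+ i) A T <->
  forall e : R, 0 < e -> exists N, forall n, (N <= n)%N ->
    op_le e (fun x => T x - psum A h n x).
Proof.
have psumE n x : psum A h n x = \sum_(i < n) h ^+ i *: A i x.
  by rewrite /psum big_mkord.
split=> hT e e0.
  have [|N _ hN] := hT (toK rs e); first by rewrite toK_gt0.
  exists N => n Nn x; have := hN n Nn x.
  by rewrite -psumE -(toK_rn x) -rmorphM rn_leP.
have eE := ofK_K rs (ltW e0).
have [|N hN] := hT (ofK rs e); first by rewrite -toK_gt0 eE.
exists N => // n /= Nn x.
rewrite -psumE -(toK_rn x) -eE -rmorphM rn_leP; exact: hN.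
Qed.

Lemma op_sum_cvg T x : op_sum (fun i => h ^+ i) A T ->
  (fun n => psum A h n x) @ \oo --> T x.
Proof.
move=> /op_sumP hT; apply/cvg_rnP => e e0.
have e0' : 0 < e / (rn x + 1).
  by rewrite divr_gt0 //; have := rn_ge0 x; lra.
have [N hN] := hT _ e0'; exists N => n Nn.
apply: le_trans (hN n Nn x) _.
have x0 := rn_ge0 x.
by rewrite mulrAC ler_pdivrMr ?ler_wpM2l //; lra.
Qed.

Lemma op_sum_unique T T' : op_sum (fun i => h ^+ i) A T ->
  op_sum (fun i => h ^+ i) A T' -> T =1 T'.
Proof.
move=> hT hT' x.
exact: (cvg_unique (@norm_hausdorff K W) (op_sum_cvg hT) (op_sum_cvg hT')).
Qed.

Lemma op_sum_linear T : (forall i, linear (A i)) ->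
  op_sum (fun i => h ^+ i) A T -> linear T.
Proof.
move=> lA hT a x y.
suff : (fun n => psum A h n (a *: x + y)) @ \oo --> a *: T x + T y.
  by move=> h2; exact: (cvg_unique (@norm_hausdorff K W) (op_sum_cvg hT) h2).
have -> : (fun n => psum A h n (a *: x + y)) =
          (fun n => a *: psum A h n x + psum A h n y).
  apply/funext => n.
  apply: (@linear_sum_natP _ _ _ 0 n (fun i x => h ^+ i *: A i x)) => i _.
  exact: linear_scaleP.
apply: cvgD; last exact: op_sum_cvg.
by apply: cvgZ; [exact: cvg_cst | exact: op_sum_cvg].
Qed.

Section Bounds.
Variables (c r : R).
Hypotheses (c0 : 0 <= c) (r0 : 0 <= r) (Acr : geo_le c r A) (hr : r * rn h <= 2^-1).

Let q0 : 0 <= r * rn h. Proof. by rewrite mulr_ge0 // rn_ge0. Qed.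

Let step x n : rn (psum A h n.+1 x - psum A h n x) <= c * rn x * (r * rn h) ^+ n.
Proof.
rewrite /psum big_nat_recr //= addrAC subrr add0r rnZ rnX.
apply: le_trans (ler_wpM2l _ (Acr n x)) _; first by rewrite exprn_ge0 // rn_ge0.
by rewrite exprMn le_eqVlt; apply/orP; left; apply/eqP; ring.
Qed.

Lemma psum_dist x n m : (n <= m)%N ->
  rn (psum A h m x - psum A h n x) <= 2 * (c * rn x) * (r * rn h) ^+ n.
Proof.
apply: (@geometric_dist W (fun n => psum A h n x)) => //.
- by rewrite mulr_ge0 // rn_ge0.
- by rewrite q0.
Qed.

Lemma op_sum_tail T : op_sum (fun i => h ^+ i) A T ->
  forall n x, rn (T x - psum A h n x) <= 2 * (c * rn x) * (r * rn h) ^+ n.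
Proof.
move=> hT n x; apply: rn_le_eps => e e0.
have /cvg_rnP/(_ e e0)[N hN] := op_sum_cvg (x := x) hT.
rewrite -(subrKA (psum A h (N + n)%N x)) addrC; apply: le_trans (rnD _ _) _.
by apply: lerD; [apply: psum_dist; rewrite leq_addl | apply: hN; rewrite leq_addr].
Qed.

Lemma op_sum_op_le T : op_sum (fun i => h ^+ i) A T -> op_le (2 * c) T.
Proof.
move=> hT x; have := op_sum_tail hT 0%N x.
by rewrite /psum big_geq // subr0 expr0 mulr1 mulrA.
Qed.

Lemma op_sum_of_tail (a : R) T : (forall n x,
    rn (T x - psum A h n x) <= a * 2^-1 ^+ n * rn x) ->
  op_sum (fun i => h ^+ i) A T.
Proof.
move=> hT; apply/op_sumP => e e0; have [N hN] := exists_expr2_lt a e0.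
exists N => n Nn x; apply: le_trans (hT n x) _.
by apply: ler_wpM2r (hN n Nn); apply: rn_ge0.
Qed.

End Bounds.
End OpSum.

Lemma op_sum_series (V : normedModType K) (W : completeNormedModType K)
    (A : nat -> V -> W) (h : K) (c r : R) :
  0 <= c -> 0 <= r -> geo_le c r A -> r * rn h <= 2^-1 ->
  op_sum (fun i => h ^+ i) A (op_series A h).
Proof.
move=> c0 r0 Acr hr; have q0 : 0 <= r * rn h by rewrite mulr_ge0 // rn_ge0.
apply: (@op_sum_of_tail _ _ _ _ (2 * c)) => n x.
have cx : 0 <= c * rn x by rewrite mulr_ge0 // rn_ge0.
have q01 : 0 <= r * rn h <= 2^-1 by rewrite q0.
have [|l ul hl] := @geometric_cvg W (fun n => psum A h n x) _ _ cx q01.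
  move=> m; rewrite /psum big_nat_recr //= addrAC subrr add0r rnZ rnX.
  apply: le_trans (ler_wpM2l _ (Acr m x)) _; first by rewrite exprn_ge0 // rn_ge0.
  by rewrite exprMn le_eqVlt; apply/orP; left; apply/eqP; ring.
have -> : op_series A h x = l.
  rewrite /op_series; apply: (norm_cvg_lim (V := W)).
  by under eq_fun do rewrite -(big_mkord xpredT (fun i => h ^+ i *: A i x)).
apply: le_trans (hl n) _; rewrite mulrA mulrAC.
rewrite ler_wpM2r ?rn_ge0 // ler_wpM2l //; first by lra.
by rewrite lerXn2r // nnegrE // invr_ge0.
Qed.

(** Analyticity at a point with explicit data: convergence on a disc and a Cauchy estimate |A_i| <=
    c r^i. The estimate controls the tails when series are multiplied, inverted or rearranged. *)
Definition expands (V W : normedModType K) (z0 : K) (A : nat -> V -> W)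
    (F : K -> V -> W) : Prop :=
  (forall i, linear (A i)) /\
  exists c r d : R, [/\ 0 <= c, 0 < r, 0 < d, geo_le c r A &
    forall h, rn h < d -> op_sum (fun i => h ^+ i) A (F (z0 + h))].

Lemma geo_leW (V W : normedModType K) (A : nat -> V -> W) (c r c' r' : R) :
  0 <= c <= c' -> 0 <= r <= r' -> geo_le c r A -> geo_le c' r' A.
Proof.
move=> /andP[c0 cc] /andP[r0 rr] Acr i x; apply: le_trans (Acr i x) _.
rewrite ler_wpM2r ?rn_ge0 // ler_pM // ?exprn_ge0 //.
by rewrite lerXn2r // nnegrE // (le_trans r0).
Qed.

(* The ratio [r'] may be chosen, so that two expansions can share one. *)
Lemma expandsE (V W : normedModType K) (z0 : K) (A : nat -> V -> W)
    (F : K -> V -> W) : expands z0 A F ->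
  exists c r : R, [/\ 0 <= c, 0 < r & forall r', r <= r' -> exists2 d : R, 0 < d &
    geo_le c r' A /\ forall h, rn h < d -> r' * rn h <= 4^-1 /\
      op_sum (fun i => h ^+ i) A (F (z0 + h))].
Proof.
move=> [lA [c [r [d [c0 r0 d0 Acr hF]]]]]; exists c, r; split=> // r' rr'.
have r'0 : 0 < r' by apply: lt_le_trans rr'.
exists (Num.min d (4^-1 / r')).
  by rewrite lt_min d0 divr_gt0 // invr_gt0.
split; first by apply: geo_leW Acr; rewrite ?c0 ?lexx ?(ltW r0).
move=> h; rewrite lt_min => /andP[hd hr]; split; last exact: hF.
by rewrite mulrC -ler_pdivlMr // ltW.
Qed.

Lemma expands_ext (V W : normedModType K) (z0 : K) (A A' : nat -> V -> W)
    (F F' : K -> V -> W) (d : R) : (forall i, A i =1 A' i) -> 0 < d ->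
  (forall h, rn h < d -> F (z0 + h) =1 F' (z0 + h)) ->
  expands z0 A F -> expands z0 A' F'.
Proof.
move=> AA d0 FF [lA [c [r [d' [c0 r0 d'0 Acr hF]]]]]; split.
  by move=> i; apply: linear_extP (lA i) => x; rewrite AA.
exists c, r, (Num.min d d'); split=> //.
- by rewrite lt_min d0.
- by move=> i x; rewrite -AA; apply: Acr.
- move=> h; rewrite lt_min => /andP[hd hd'] e e0.
  have [N _ hN] := hF h hd' e e0; exists N => // n /= Nn x.
  rewrite -FF // (eq_bigr (fun i : 'I_n => h ^+ i *: A i x)); first exact: hN.
  by move=> i _; rewrite AA.
Qed.

Lemma expands_unique (V W : normedModType K) (z0 : K) (A A' : nat -> V -> W)
    (F F' : K -> V -> W) : (forall i, A i =1 A' i) ->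
  expands z0 A F -> expands z0 A' F' ->
  exists2 d : R, 0 < d & forall h, rn h < d -> F (z0 + h) =1 F' (z0 + h).
Proof.
move=> AA FA FA'.
have [lA [c [r [d [c0 r0 d0 Acr hF]]]]] : expands z0 A' F.
  exact: (expands_ext AA ltr01 _ FA).
have [_ [c' [r' [d' [_ _ d'0 _ hF']]]]] := FA'.
exists (Num.min d d'); first by rewrite lt_min d0.
move=> h; rewrite lt_min => /andP[hd hd'].
exact: op_sum_unique (hF _ hd) (hF' _ hd').
Qed.

Lemma expands_bounded (V W : normedModType K) (z0 : K) (A : nat -> V -> W)
    (F : K -> V -> W) : expands z0 A F ->
  exists2 d : R, 0 < d & forall h, rn h < d -> bounded_op (F (z0 + h)).
Proof.
move=> FA; have [c [r [c0 r0 h]]] := expandsE FA.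
have [d d0 [Acr hd]] := h r (lexx r); exists d => // z zd.
have [zr zF] := hd z zd; apply/bounded_opP; split.
  exact: op_sum_linear FA.1 zF.
exists (2 * c); first by lra.
by apply: op_sum_op_le zF; [| apply: ltW r0 | exact: Acr | lra].
Qed.

Lemma expands_coef_bounded (V W : normedModType K) (z0 : K) (A : nat -> V -> W)
    (F : K -> V -> W) : expands z0 A F -> forall i, bounded_op (A i).
Proof.
move=> [lA [c [r [d [c0 r0 d0 Acr _]]]]] i; apply/bounded_opP.
split=> //; exists (c * r ^+ i); last exact: Acr.
by rewrite mulr_ge0 // exprn_ge0 // ltW.
Qed.

Lemma psum_at0 (V W : normedModType K) (A : nat -> V -> W) n x :
  psum A 0 n.+1 x = A 0%N x.
Proof.
rewrite /psum big_ltn // expr0 scale1r big_nat big1 ?addr0 // => i i1.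
by rewrite expr0n gtn_eqF ?scale0r //; lia.
Qed.

Lemma expands_center (V W : normedModType K) (z0 : K) (A : nat -> V -> W)
    (F : K -> V -> W) : expands z0 A F -> F z0 =1 A 0%N.
Proof.
move=> [lA [c [r [d [c0 r0 d0 Acr hF]]]]] x.
have := hF 0; rewrite rn0 addr0 => /(_ d0) hF0.
have F0 := op_sum_cvg (x := x) hF0.
suff FA : (fun n => psum A 0 n x) @ \oo --> A 0%N x.
  exact: (cvg_unique (@norm_hausdorff K W) F0 FA).
apply/cvg_rnP => e e0; exists 1%N => -[//|n] _.
by rewrite psum_at0 subrr rn0 ltW.
Qed.

Lemma expands_poly (V W : normedModType K) (n : nat) (A : nat -> V -> W) (z0 : K)
    (F : K -> V -> W) :
  (forall i, bounded_op (A i)) -> (forall i, (n <= i)%N -> A i =1 fun=> 0) ->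
  (forall h, F (z0 + h) =1 psum A h n) -> expands z0 A F.
Proof.
move=> bA A0 FE; split; first by move=> i; case: (bA i).
have [c c0 hc] : exists2 c : R, 0 <= c & forall i, op_le c (A i).
  suff [c c0 hc] : exists2 c : R, 0 <= c & forall i, (i < n)%N -> op_le c (A i).
    exists c => // i x; have [/hc //|/A0 ->] := ltnP i n.
    by rewrite rn0 mulr_ge0 // rn_ge0.
  elim: n {A0 FE} => [|n [c c0 hc]]; first by exists 0.
  have /bounded_opP[_ [c' c'0 hc']] := bA n.
  exists (c + c'); first by rewrite addr_ge0.
  move=> i; rewrite ltnS leq_eqVlt => /orP[/eqP ->|/hc {}hc] x.
    by apply: le_trans (hc' x) _; rewrite ler_wpM2r ?rn_ge0 // lerDr.
  by apply: le_trans (hc x) _; rewrite ler_wpM2r ?rn_ge0 // lerDl.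
exists c, 1, 1; split=> //.
  by move=> i x; rewrite expr1n mulr1; apply: hc.
move=> h _; apply/op_sumP => e e0; exists n => m nm x.
rewrite FE [psum A h m x]/psum (@big_cat_nat _ _ _ n) //=.
rewrite -/(psum A h n x) (_ : \sum_(n <= i < m) _ = 0).
  by rewrite addr0 subrr rn0 mulr_ge0 ?rn_ge0 // ltW.
by rewrite big_nat big1 // => i /andP[ni _]; rewrite A0 // scaler0.
Qed.

Lemma expands_cst (V W : normedModType K) (z0 : K) (T : V -> W) : bounded_op T ->
  expands z0 (fun i => if i is 0 then T else fun=> 0) (fun=> T).
Proof.
move=> bT; apply: (@expands_poly _ _ 1%N).
- case=> [//|i]; apply/bounded_opP; split; first exact: linear_zeroP.
  by exists 0 => // x; rewrite rn0 mul0r.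
- by case.
- by move=> h x; rewrite /psum big_nat1 expr0 scale1r.
Qed.

(** Tails of products consist of n terms of size q^n. A ratio of at most 1/4 = (1/2)^2 absorbs the
    factor n <= 2^n and still leaves 2^-n; hence the 1/4 in [expandsE]. *)
Lemma quarter_pow (q : R) n : 0 <= q <= 4^-1 ->
  q ^+ n <= 2^-1 ^+ n /\ n%:R * q ^+ n <= 2^-1 ^+ n.
Proof.
move=> /andP[q0 q1].
have q4 : q ^+ n <= 2^-1 ^+ n * 2^-1 ^+ n.
  rewrite -exprMn lerXn2r ?nnegrE //; lra.
have p0 : 0 <= (2^-1 : R) ^+ n by rewrite exprn_ge0 // invr_ge0.
have np : n%:R * (2^-1 : R) ^+ n <= 1.
  rewrite exprVn ler_pdivrMr ?exprn_gt0 // mul1r -natrX ler_nat.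
  by apply: ltnW; apply: ltn_expl.
split.
  apply: le_trans q4 _; rewrite -[leRHS]mulr1 ler_wpM2l //.
  by rewrite exprn_ile1 //; lra.
apply: le_trans (ler_wpM2l _ q4) _ => //.
by rewrite mulrA -[leRHS]mul1r ler_wpM2r.
Qed.

(** * Cauchy products *)

Section Product.
Variables (V W X : normedModType K).

Definition cauchy_prod (A : nat -> W -> X) (B : nat -> V -> W) (m : nat) (x : V) : X :=
  \sum_(0 <= i < m.+1) A i (B (m - i)%N x).

Lemma psum_cauchy (A : nat -> W -> X) (B : nat -> V -> W) h n x :
  (forall i, linear (A i)) ->
  psum (cauchy_prod A B) h n x = \sum_(0 <= i < n) h ^+ i *: A i (psum B h (n - i) x).
Proof.
move=> lA; rewrite /psum /cauchy_prod.
under eq_bigr do rewrite scaler_sumr.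
rewrite -(exchange_triangle _ _ (fun i m => h ^+ m *: A i (B (m - i)%N x))).
apply: eq_big_nat => i iN; rewrite (lin_map_sum (lA i)) scaler_sumr.
rewrite -{1}[(i : nat)]add0n big_addn; apply: eq_big_nat => l lN.
by rewrite addnK (lin_mapZ (lA i)) scalerA exprD mulrC.
Qed.

Lemma expands_comp (z0 : K) (A : nat -> W -> X) (B : nat -> V -> W)
    (F : K -> W -> X) (G : K -> V -> W) :
  expands z0 A F -> expands z0 B G ->
  expands z0 (cauchy_prod A B) (fun z => F z \o G z).
Proof.
move=> FA GB; have lA := FA.1; have lB := GB.1.
have [c [r1 [c0 r10 /(_ (r1 + _)) hA]]] := expandsE FA.
have [c' [r2 [c'0 r20 /(_ (r1 + r2)) hB]]] := expandsE GB.
have [|d1 d10 [Ac hF]] := hA r2; first by lra.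
have [|d2 d20 [Bc hG]] := hB; first by lra.
set r := r1 + r2 in Ac hF Bc hG.
have r0 : 0 < r by rewrite /r; lra.
split.
  move=> m; apply: (@linear_sum_natP _ _ _ 0 m.+1 (fun i x => A i (B (m - i)%N x))).
  by move=> i _; apply: linear_compP.
(* The ratio doubles because coefficient [m] has m + 1 <= 2^m terms, each bounded by c c' r^m. *)
exists (c * c'), (2 * r), (Num.min d1 d2); split.
- by rewrite mulr_ge0.
- by lra.
- by rewrite lt_min d10.
- move=> m x; rewrite /cauchy_prod.
  apply: le_trans (_ : \sum_(0 <= i < m.+1) c * c' * r ^+ m * rn x <= _).
    apply: rn_sum_le => i im; apply: le_trans (Ac _ _) _.
    apply: le_trans (ler_wpM2l _ (Bc _ _)) _.
      by rewrite mulr_ge0 // exprn_ge0 // ltW.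
    have -> : r ^+ m = r ^+ i * r ^+ (m - i) by rewrite -exprD subnKC //; lia.
    by rewrite le_eqVlt; apply/orP; left; apply/eqP; ring.
  rewrite sumr_const_nat subn0 -[leLHS]mulr_natr.
  rewrite [leRHS](_ : _ = c * c' * r ^+ m * rn x * 2 ^+ m); last first.
    by rewrite exprMn; set a := 2 ^+ m; ring.
  rewrite ler_wpM2l //; last by rewrite -natrX ler_nat; apply: ltn_expl.
  by rewrite !mulr_ge0 ?rn_ge0 // exprn_ge0 // ltW.
- move=> h; rewrite lt_min => /andP[/hF[hq hFh] /hG[_ hGh]].
  set q := r * rn h in hq.
  have q0 : 0 <= q by rewrite mulr_ge0 ?rn_ge0 // ltW.
  have q2 : q <= 2^-1 by lra.
  have tA := op_sum_tail c0 (ltW r0) Ac q2 hFh.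
  have tB := op_sum_tail c'0 (ltW r0) Bc q2 hGh.
  have bG := op_sum_op_le c'0 (ltW r0) Bc q2 hGh.
  (* 6 = 4 + 2: the tail of A at G x, where |G x| <= 2 c' |x|, and the tails of B inside the partial
     sum of A. *)
  apply: (@op_sum_of_tail _ _ _ _ (6 * (c * c'))) => n x /=.
  set Gx := G (z0 + h) x.
  have -> : F (z0 + h) Gx - psum (cauchy_prod A B) h n x =
      (F (z0 + h) Gx - psum A h n Gx) +
      \sum_(0 <= i < n) h ^+ i *: A i (Gx - psum B h (n - i) x).
    rewrite psum_cauchy // -[LHS](subrKA (psum A h n Gx)); congr (_ + _).
    rewrite -sumrB; apply: eq_bigr => i _.
    by rewrite (lin_mapB (lA i)) scalerBr.
  apply: le_trans (rnD _ _) _.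
  have x0 := rn_ge0 x.
  have h1 : rn (F (z0 + h) Gx - psum A h n Gx) <= 4 * (c * c' * rn x * q ^+ n).
    apply: le_trans (tA n Gx) _.
    have -> : 4 * (c * c' * rn x * q ^+ n) = 2 * (c * (2 * c' * rn x)) * q ^+ n by ring.
    rewrite ler_wpM2r ?exprn_ge0 // ler_wpM2l // ler_wpM2l //; exact: bG.
  have h2 : rn (\sum_(0 <= i < n) h ^+ i *: A i (Gx - psum B h (n - i) x)) <=
      2 * (c * c' * rn x * (n%:R * q ^+ n)).
    apply: le_trans (_ : \sum_(0 <= i < n) 2 * (c * c' * rn x * q ^+ n) <= _); last first.
      rewrite sumr_const_nat subn0 -[leLHS]mulr_natr le_eqVlt; apply/orP; left; apply/eqP.
      by ring.
    apply: rn_sum_le => i iN; rewrite rnZ rnX.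
    have hi : 0 <= rn h ^+ i by rewrite exprn_ge0 // rn_ge0.
    have ri : 0 <= c * r ^+ i by rewrite mulr_ge0 // exprn_ge0 // ltW.
    apply: le_trans (ler_wpM2l hi (Ac i _)) _.
    apply: le_trans (ler_wpM2l hi (ler_wpM2l ri (tB _ x))) _.
    have -> : q ^+ n = rn h ^+ i * r ^+ i * q ^+ (n - i).
      rewrite -exprMn [rn h * r]mulrC -/q -exprD subnKC //.
      by case/andP: iN => _ /ltnW.
    rewrite -/q; move: (q ^+ _) => p.
    by rewrite le_eqVlt; apply/orP; left; apply/eqP; ring.
  have [|p1 p2] := @quarter_pow q n; first by rewrite q0.
  have w0 : 0 <= c * c' * rn x by rewrite !mulr_ge0.
  have := ler_wpM2l w0 p1; have := ler_wpM2l w0 p2.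
  have -> : 6 * (c * c') * 2^-1 ^+ n * rn x = 6 * (c * c' * rn x * 2^-1 ^+ n).
    by set a := 2^-1 ^+ n; ring.
  move: h1 h2; lra.
Qed.

End Product.

Lemma expands_sum (V W : normedModType K) (z0 : K) (m n : nat)
    (A : nat -> nat -> V -> W) (F : nat -> K -> V -> W) :
  (forall j, (m <= j < n)%N -> expands z0 (A j) (F j)) ->
  exists A', expands z0 A' (fun z x => \sum_(m <= j < n) F j z x).
Proof.
elim: n => [|n IH] hF.
  exists (fun i => if i is 0 then fun=> 0 else fun=> 0).
  apply: (expands_ext (d := 1) _ ltr01 _ (expands_cst (T := fun=> 0) z0 _)) => //.
  - by move=> h _ x; rewrite big_geq.
  - apply/bounded_opP; split; first exact: linear_zeroP.
    by exists 0 => // x; rewrite rn0 mul0r.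
have [mn|nm] := leqP m n; last first.
  exists (fun i => if i is 0 then fun=> 0 else fun=> 0).
  apply: (expands_ext (d := 1) _ ltr01 _ (expands_cst (T := fun=> 0) z0 _)) => //.
  - by move=> h _ x; rewrite big_geq.
  - apply/bounded_opP; split; first exact: linear_zeroP.
    by exists 0 => // x; rewrite rn0 mul0r.
have [|A1 hA1] := IH; first by move=> j jn; apply: hF; lia.
have hA2 := hF n ltac:(lia).
exists (fun i x => A1 i x + A n i x).
have l1 := hA1.1; have l2 := hA2.1.
have [c [r1 [c0 r10 /(_ (r1 + _)) h1]]] := expandsE hA1.
have [c' [r2 [c'0 r20 /(_ (r1 + r2)) h2]]] := expandsE hA2.
have [|d1 d10 [Ac hF1]] := h1 r2; first by lra.
have [|d2 d20 [Bc hF2]] := h2; first by lra.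
split; first by move=> i; apply: linear_addP.
exists (c + c'), (r1 + r2), (Num.min d1 d2); split.
- by lra.
- by lra.
- by rewrite lt_min d10.
- move=> i x; apply: le_trans (rnD _ _) _; rewrite !mulrDl.
  by apply: lerD; [apply: Ac | apply: Bc].
- move=> h; rewrite lt_min => /andP[/hF1[_ /op_sumP s1] /hF2[_ /op_sumP s2]].
  apply/op_sumP => e e0; have e2 : 0 < e / 2 by lra.
  have [N1 hN1] := s1 _ e2; have [N2 hN2] := s2 _ e2.
  exists (N1 + N2)%N => p Np x.
  have u1 := hN1 p ltac:(lia) x; have u2 := hN2 p ltac:(lia) x.
  rewrite big_nat_recr //= (_ : psum _ h p x = psum A1 h p x + psum (A n) h p x).
    rewrite opprD addrACA; apply: le_trans (rnD _ _) _; lra.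
  by rewrite /psum -big_split; apply: eq_bigr => i _; rewrite /= scalerDr.
Qed.

(** * Inversion of near identity series *)

Section Inverse.
Variables (V : completeNormedModType K).
Implicit Types (A : nat -> V -> V) (F : K -> V -> V).

(** The coefficients N_0 = I, N_m = - (A_1 N_(m-1) + ... + A_m N_0) need all earlier ones. The table
    at stage [n] holds those up to [n], which makes the recursion structural. *)
Fixpoint inv_table A (n : nat) : nat -> V -> V :=
  if n is n'.+1 then
    fun m => if (m <= n')%N then inv_table A n' m
             else fun x => - \sum_(1 <= i < n'.+2) A i (inv_table A n' (n'.+1 - i)%N x)
  else fun=> id.

Definition inv_coef A (m : nat) : V -> V := inv_table A m m.

Lemma inv_tableE A n m : (m <= n)%N -> inv_table A n m = inv_coef A m.
Proof.
elim: n => [|n IH]; first by rewrite leqn0 => /eqP ->.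
rewrite leq_eqVlt => /orP[/eqP -> //|]; rewrite ltnS => mn /=.
by rewrite mn IH.
Qed.

Lemma inv_coefS A m x :
  inv_coef A m.+1 x = - \sum_(1 <= i < m.+2) A i (inv_coef A (m.+1 - i)%N x).
Proof.
rewrite {1}/inv_coef /= ltnn; congr (- _); apply: eq_big_nat => i im.
by rewrite inv_tableE //; lia.
Qed.

Lemma cauchy_inv A m : A 0%N =1 id ->
  cauchy_prod A (inv_coef A) m =1 (if m is 0 then id else fun=> 0).
Proof.
move=> A0 x; rewrite /cauchy_prod; case: m => [|m].
  by rewrite big_nat1 A0.
by rewrite big_ltn // A0 subn0 inv_coefS addNr.
Qed.

(** For s = r (1 + c) one has s - r = c r, so the geometric sum collapses to s^m - r^m. This is why
    s is the right ratio for the inverse series. *)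
Lemma inv_coef_sum (c r : R) m : 0 <= c -> 0 <= r ->
  \sum_(1 <= i < m.+1) c * r ^+ i * (r * (1 + c)) ^+ (m - i) <=
  (r * (1 + c)) ^+ m - r ^+ m.
Proof.
move=> c0 r0; set s := r * (1 + c).
elim: m => [|m IH]; first by rewrite big_geq // !expr0 subrr.
rewrite big_nat_recr //= subnn expr0 mulr1.
rewrite (_ : \sum_(_ <= _ < _) _ =
    s * \sum_(1 <= i < m.+1) c * r ^+ i * s ^+ (m - i)); last first.
  rewrite mulr_sumr; apply: eq_big_nat => i im.
  by rewrite subSn ?exprS; [ring | lia].
have s0 : 0 <= s by rewrite /s mulr_ge0 //; lra.
have sE : s * r ^+ m = r * r ^+ m + c * (r * r ^+ m) by rewrite /s; ring.
have := ler_wpM2l s0 IH; rewrite !exprS mulrBr sE.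
move: (s * s ^+ m) (r * r ^+ m) (s * \sum_(_ <= _ < _) _) (c * _) => a b w e; lra.
Qed.

Lemma inv_coef_linear A : (forall i, linear (A i)) -> forall m, linear (inv_coef A m).
Proof.
move=> lA; elim/ltn_ind => -[_ //|m IH].
apply: linear_extP => [x|]; first exact: inv_coefS.
apply: linear_oppP; apply: linear_sum_natP => i im.
by apply: linear_compP => //; apply: IH; lia.
Qed.

Lemma inv_coef_le A (c r : R) : 0 <= c -> 0 <= r -> geo_le c r A ->
  geo_le 1 (r * (1 + c)) (inv_coef A).
Proof.
move=> c0 r0 Ac; set s := r * (1 + c).
have s0 : 0 <= s by rewrite /s mulr_ge0 //; lra.
move=> m; rewrite mul1r; elim/ltn_ind: m => -[_|m IH] x.
  by rewrite expr0 mul1r.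
rewrite inv_coefS rnN.
apply: le_trans (_ : \sum_(1 <= i < m.+2) c * r ^+ i * s ^+ (m.+1 - i) * rn x <= _).
  apply: rn_sum_le => i im; apply: le_trans (Ac _ _) _.
  rewrite -[leRHS]mulrA ler_wpM2l ?mulr_ge0 ?exprn_ge0 //.
  by apply: IH; lia.
rewrite -mulr_suml ler_wpM2r ?rn_ge0 //.
apply: le_trans (inv_coef_sum _ c0 r0) _.
by rewrite gerBl exprn_ge0.
Qed.

Lemma expands_right_inverse (z0 : K) A F : expands z0 A F -> A 0%N =1 id ->
  exists N Fi, [/\ N 0%N =1 id, expands z0 N Fi &
    exists2 d : R, 0 < d & forall h, rn h < d ->
      cancel (Fi (z0 + h)) (F (z0 + h))].
Proof.
move=> FA A0; have [lA [c [r [d [c0 r0 d0 Ac hF]]]]] := FA.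
pose Fi z := op_series (inv_coef A) (z - z0).
have FN : expands z0 (inv_coef A) Fi.
  split; first exact: inv_coef_linear.
  have s0 : 0 < r * (1 + c) by rewrite mulr_gt0 //; lra.
  exists 1, (r * (1 + c)), (2^-1 / (r * (1 + c))); split=> //.
  - by rewrite divr_gt0 // invr_gt0.
  - exact: inv_coef_le (ltW r0) Ac.
  - move=> h hd; rewrite /Fi addrC addKr.
    apply: (op_sum_series (c := 1) (r := r * (1 + c))) => //.
    + exact: ltW.
    + exact: inv_coef_le (ltW r0) Ac.
    + by rewrite mulrC -ler_pdivlMr // ltW.
exists (inv_coef A), Fi; split=> //.
have bid : bounded_op (@id V) by split=> // x; exact: cvg_id.
apply: (expands_unique (A := cauchy_prod A (inv_coef A))
  (F := fun z => F z \o Fi z) (F' := fun=> id) _ _ (expands_cst z0 bid)).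
  by move=> i; exact: cauchy_inv.
exact: expands_comp.
Qed.

(** The right inverse again has leading coefficient I, so it has a right inverse of its own, which
    must coincide with F; hence it is two-sided. *)
Lemma expands_inverse (z0 : K) A F : expands z0 A F -> A 0%N =1 id ->
  exists N Fi, [/\ N 0%N =1 id, expands z0 N Fi &
    exists2 d : R, 0 < d & forall h, rn h < d ->
      cancel (Fi (z0 + h)) (F (z0 + h)) /\ cancel (F (z0 + h)) (Fi (z0 + h))].
Proof.
move=> FA A0; have [N [Fi [N0 FN [d d0 FFi]]]] := expands_right_inverse FA A0.
have [_ [Fii [_ _ [d' d'0 FiFii]]]] := expands_right_inverse FN N0.
exists N, Fi; split=> //; exists (Num.min d d'); first by rewrite lt_min d0.
move=> h; rewrite lt_min => /andP[/FFi h1 /FiFii h2]; split=> // x.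
by rewrite -{1}(h2 x) h1 h2.
Qed.

End Inverse.

(** * Change of centre *)

Lemma bin_le_expn2 n m : ('C(n, m) <= 2 ^ n)%N.
Proof.
elim: n m => [|n IH] [|m]; rewrite ?bin0 ?expn_gt0 //.
by rewrite binS expnS mul2n -addnn leq_add.
Qed.

(** The series is rearranged by powers of h = z - z0 with the binomial theorem. This gives the
    expansions at all points of a disc that [analytic_on] asks for, over R as well as over C. *)
Lemma expands_recenter (V : normedModType K) (W : completeNormedModType K)
    (A : nat -> V -> W) (F : K -> V -> W) : expands 0 A F ->
  exists2 d : R, 0 < d & forall z0, rn z0 < d -> exists A', expands z0 A' F.
Proof.
move=> FA; have lA := FA.1.
have [c [r [c0 r0 /(_ r (lexx r))[d d0 [Ac hF]]]]] := expandsE FA.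
have r8 : 0 < 8^-1 / r by rewrite divr_gt0 // invr_gt0.
(* d / 2 keeps z0 + h in the disc of convergence. 1 / (8 r) makes 2 r |z0| and 2 r |h| at most 1/4;
   the factor 2 is the price of bounding binomial coefficients by powers of 2. *)
pose d' := Num.min (d / 2) (8^-1 / r).
have d'0 : 0 < d' by rewrite lt_min r8; apply/andP; split=> //; lra.
have d'P h : rn h < d' -> rn h < d / 2 /\ 2 * r * rn h <= 4^-1.
  rewrite lt_min => /andP[-> hr]; split=> //.
  have : rn h * r <= 8^-1 by rewrite -ler_pdivlMr // ltW.
  by lra.
exists d' => // z0 /d'P[z0d z0r].
pose t m l (x : V) := ('C(l + m, m)%:R : K) *: A (l + m)%N x.
have tc m : geo_le (c * (2 * r) ^+ m) (2 * r) (t m).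
  move=> l x; rewrite /t rnZ rn_nat.
  apply: le_trans (_ : (2 ^+ (l + m)) * (c * r ^+ (l + m) * rn x) <= _).
    apply: ler_pM; rewrite ?rn_ge0 ?Ac // -natrX ler_nat.
    exact: bin_le_expn2.
  rewrite !exprMn !exprD.
  move: (2 ^+ l) (2 ^+ m) (r ^+ l) (r ^+ m) => a1 a2 a3 a4.
  by rewrite le_eqVlt; apply/orP; left; apply/eqP; ring.
have cm m : 0 <= c * (2 * r) ^+ m by rewrite mulr_ge0 // exprn_ge0 //; lra.
have r2 : 0 <= 2 * r by lra.
have z0r2 : 2 * r * rn z0 <= 2^-1 by lra.
pose B m := op_series (t m) z0.
have lt m l : linear (t m l) by apply: linear_scaleP; apply: lA.
have hB m : op_sum (fun i => z0 ^+ i) (t m) (B m).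
  exact: (op_sum_series (cm m) r2 (tc m) z0r2).
exists B; split; first by move=> m; exact: (op_sum_linear (lt m) (hB m)).
exists (2 * c), (2 * r), d'; split=> //; [lra | lra | | ].
  move=> m x; apply: le_trans (op_sum_op_le (cm m) r2 (tc m) z0r2 (hB m) x) _.
  by rewrite mulrA.
move=> h /d'P[hd hr].
have [|zr hFz] := hF (z0 + h); first by apply: le_lt_trans (rnD _ _) _; lra.
rewrite add0r in hFz.
apply: (@op_sum_of_tail _ _ _ _ (4 * c)) => n x.
have psumE : psum A (z0 + h) n x =
    \sum_(0 <= m < n) h ^+ m *: psum (t m) z0 (n - m) x.
  rewrite /psum.
  transitivity (\sum_(0 <= i < n) \sum_(0 <= m < i.+1)
      (h ^+ m * z0 ^+ (i - m)) *: ('C(i, m)%:R *: A i x)).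
    apply: eq_bigr => i _; rewrite exprDn scaler_suml -(big_mkord xpredT
      (fun j => ((z0 ^+ (i - j) * h ^+ j) *+ 'C(i, j)) *: A i x)).
    by apply: eq_bigr => m _; rewrite scalerA mulr_natr [z0 ^+ _ * _]mulrC.
  rewrite -(exchange_triangle _ _
    (fun m i => (h ^+ m * z0 ^+ (i - m)) *: ('C(i, m)%:R *: A i x))).
  apply: eq_big_nat => m mn; rewrite scaler_sumr -{1}[(m : nat)]add0n big_addn.
  by apply: eq_big_nat => l ln; rewrite /t addnK -scalerA.
have -> : F (z0 + h) x - psum B h n x = (F (z0 + h) x - psum A (z0 + h) n x) -
    \sum_(0 <= m < n) h ^+ m *: (B m x - psum (t m) z0 (n - m) x).
  rewrite -[LHS](subrKA (psum A (z0 + h) n x)); congr (_ + _).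
  rewrite psumE /psum -sumrB -sumrN; apply: eq_bigr => m _.
  by rewrite scalerBr opprB.
apply: le_trans (rnB _ _) _.
have x0 := rn_ge0 x.
have q4 : 0 <= (4^-1 : R) <= 4^-1 by lra.
have zr2 : r * rn (z0 + h) <= 2^-1 by lra.
have h1 : rn (F (z0 + h) x - psum A (z0 + h) n x) <= 2 * (c * rn x * 4^-1 ^+ n).
  apply: le_trans (op_sum_tail c0 (ltW r0) Ac zr2 hFz n x) _.
  rewrite [leRHS]mulrA ler_wpM2l ?mulr_ge0 //.
  by rewrite lerXn2r // nnegrE ?mulr_ge0 ?rn_ge0 ?invr_ge0 // ltW.
have h2 : rn (\sum_(0 <= m < n) h ^+ m *: (B m x - psum (t m) z0 (n - m) x)) <=
    2 * (c * rn x * (n%:R * 4^-1 ^+ n)).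
  apply: le_trans (_ : \sum_(0 <= m < n) 2 * (c * rn x * 4^-1 ^+ n) <= _); last first.
    rewrite sumr_const_nat subn0 -[leLHS]mulr_natr le_eqVlt; apply/orP; left; apply/eqP.
    by move: (4^-1 ^+ n) => a; ring.
  apply: rn_sum_le => m mn; rewrite rnZ rnX.
  have hm : 0 <= rn h ^+ m by rewrite exprn_ge0 // rn_ge0.
  apply: le_trans (ler_wpM2l hm (op_sum_tail (cm m) r2 (tc m) z0r2 (hB m) _ x)) _.
  apply: le_trans (_ : 2 * (c * rn x) *
    ((2 * r * rn h) ^+ m * (2 * r * rn z0) ^+ (n - m)) <= _).
    rewrite [(2 * r * rn h) ^+ m]exprMn; move: (_ ^+ (n - m)) ((2 * r) ^+ m) => a1 a2.
    by rewrite le_eqVlt; apply/orP; left; apply/eqP; ring.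
  rewrite [leRHS]mulrA ler_wpM2l ?mulr_ge0 //.
  have -> : (4^-1 : R) ^+ n = 4^-1 ^+ m * 4^-1 ^+ (n - m).
    by rewrite -exprD subnKC //; case/andP: mn => _ /ltnW.
  apply: ler_pM; rewrite ?exprn_ge0 ?mulr_ge0 ?rn_ge0 //; try lra.
  - by rewrite lerXn2r // nnegrE ?mulr_ge0 ?rn_ge0 ?invr_ge0 // ltW.
  - by rewrite lerXn2r // nnegrE ?mulr_ge0 ?rn_ge0 ?invr_ge0 // ltW.
have [p1 p2] := @quarter_pow 4^-1 n q4.
have w0 : 0 <= c * rn x by rewrite mulr_ge0.
have := ler_wpM2l w0 p1; have := ler_wpM2l w0 p2.
have -> : 4 * c * 2^-1 ^+ n * rn x = 4 * (c * rn x * 2^-1 ^+ n).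
  by set a := 2^-1 ^+ n; ring.
move: h1 h2; lra.
Qed.

Lemma expands_near (V W : normedModType K) (z0 : K) (A : nat -> V -> W)
    (F : K -> V -> W) : expands z0 A F ->
  \forall z \near z0, op_sum (fun i => (z - z0) ^+ i) A (F z).
Proof.
move=> [_ [c [r [d [_ _ d0 _ hF]]]]]; apply/near_rnP; exists d => // z zd.
by have := hF _ zd; rewrite [z0 + _]addrC subrK.
Qed.

Lemma bounded_idP (V : normedModType K) : bounded_op (@id V).
Proof. by split=> // x; exact: cvg_id. Qed.

Lemma bounded_scaleP (V : normedModType K) (a : K) : bounded_op (fun x : V => a *: x).
Proof.
apply/bounded_opP; split; first exact: linear_scaleP.
by exists (rn a); [exact: rn_ge0 | move=> x; rewrite rnZ].
Qed.

Lemma bounded_zeroP (V W : normedModType K) : bounded_op (fun _ : V => 0 : W).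
Proof.
apply/bounded_opP; split; first exact: linear_zeroP.
by exists 0 => // x; rewrite rn0 mul0r.
Qed.

Lemma bounded_compP (V W X : normedModType K) (S : W -> X) (T : V -> W) :
  bounded_op S -> bounded_op T -> bounded_op (fun x => S (T x)).
Proof.
move=> [lS cS] [lT cT]; split; first exact: linear_compP.
by move=> x; apply: (@continuous_comp _ _ _ T S); [exact: cT | exact: cS].
Qed.

Lemma bounded_addP (V W : normedModType K) (S T : V -> W) :
  bounded_op S -> bounded_op T -> bounded_op (fun x => S x + T x).
Proof.
move=> [lS cS] [lT cT]; split; first exact: linear_addP.
by move=> x; apply: cvgD; [exact: cS | exact: cT].
Qed.

Lemma bounded_oppP (V W : normedModType K) (T : V -> W) :
  bounded_op T -> bounded_op (fun x => - T x).
Proof.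
move=> [lT cT]; split; first exact: linear_oppP.
by move=> x; apply: cvgN; exact: cT.
Qed.

Lemma bounded_ext (V W : normedModType K) (S T : V -> W) : S =1 T ->
  bounded_op T -> bounded_op S.
Proof. by move=> /funext ->. Qed.

Lemma bounded_sum_natP (V W : normedModType K) (m n : nat) (F : nat -> V -> W) :
  (forall i, (m <= i < n)%N -> bounded_op (F i)) ->
  bounded_op (fun x => \sum_(m <= i < n) F i x).
Proof.
elim: n => [|n IH] hF.
  by apply: bounded_ext (@bounded_zeroP _ _) => x; rewrite big_geq.
have [mn|nm] := leqP m n; last first.
  by apply: bounded_ext (@bounded_zeroP _ _) => x; rewrite big_geq.
apply: bounded_ext => [x|]; first by rewrite big_nat_recr.
apply: bounded_addP; last by apply: hF; rewrite mn ltnSn.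
by apply: IH => i /andP[mi iN]; apply: hF; rewrite mi ltnW.
Qed.

(** With z = z0 + h, the family z / z0 = 1 + h / z0 has leading coefficient I, so [expands_inverse]
    applies, and 1 / z is its inverse divided by z0. Powers follow by composition. *)
Lemma expands_scalar_inv (V : completeNormedModType K) (z0 : K) (n : nat) :
  z0 != 0 -> exists A, expands z0 A (fun z (x : V) => z ^- n *: x).
Proof.
move=> z00.
have [A1 hA1] : exists A, expands z0 A (fun z (x : V) => z^-1 *: x).
  pose A i (x : V) := if i is 0 then x else if i is 1 then z0^-1 *: x else 0.
  have hA : expands z0 A (fun z x => (z / z0) *: x).
    apply: (@expands_poly _ _ 2).
    - case=> [|[|i]]; first exact: bounded_idP.
        exact: bounded_scaleP.
      exact: bounded_zeroP.
    - by case=> [|[|i]].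
    - move=> h x; rewrite /psum big_nat_recr // big_nat1 /= expr0 expr1 scale1r.
      by rewrite mulrDl divff // scalerDl scale1r scalerA.
  have [//|N [Fi [_ hN [d d0 hd]]]] := expands_inverse hA.
  have hN' := expands_comp (expands_cst z0 (bounded_scaleP V z0^-1)) hN.
  eexists; apply: (expands_ext (d := Num.min d (rn z0)) _ _ _ hN').
  - by move=> i x.
  - by rewrite lt_min d0 lt_neqAle eq_sym rn_eq0 z00 rn_ge0.
  - move=> h; rewrite lt_min => /andP[/hd[h1 h2] hz] x /=.
    have zh0 : z0 + h != 0.
      apply/eqP => zh; move: hz; have -> : h = - z0 by rewrite -(addKr z0 h) zh addr0.
      by rewrite rnN ltxx.
    have := h1 x; set y := Fi _ _ => <-.
    by rewrite scalerA mulrA mulVf // mul1r.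
elim: n => [|n [A2 hA2]].
  eexists; apply: (expands_ext (d := 1) _ ltr01 _ (expands_cst z0 (@bounded_idP V))).
  - by move=> i x.
  - by move=> h _ x; rewrite expr0 invr1 scale1r.
eexists; apply: (expands_ext (d := 1) _ ltr01 _ (expands_comp hA1 hA2)).
- by move=> i x.
- by move=> h _ x /=; rewrite scalerA exprS invfM.
Qed.

Lemma uniform_bound (n : nat) (P : nat -> R -> Prop) :
  (forall i c c', c <= c' -> P i c -> P i c') ->
  (forall i, (i < n)%N -> exists2 c, 0 <= c & P i c) ->
  exists2 c, 0 <= c & forall i, (i < n)%N -> P i c.
Proof.
move=> mono; elim: n => [|n IH] hP; first by exists 0.
have [|c c0 hc] := IH; first by move=> i iN; apply: hP; apply: ltnW.
have [c' c'0 hc'] := hP n (ltnSn n); exists (c + c'); first by rewrite addr_ge0.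
move=> i; rewrite ltnS leq_eqVlt => /orP[/eqP ->|/hc hi].
- by apply: mono hc'; rewrite lerDr.
- by apply: mono hi; rewrite lerDl.
Qed.

Lemma op_leW (V W : normedModType K) (T : V -> W) (c c' : R) : c <= c' ->
  op_le c T -> op_le c' T.
Proof. by move=> cc hT x; apply: le_trans (hT x) _; rewrite ler_wpM2r // rn_ge0. Qed.

(** A Cauchy estimate from a single point: at z = s consecutive partial sums eventually differ by at
    most 2 in norm, so |A_n| <= 2 s^-n from some N on. The finitely many earlier coefficients are
    bounded one by one. *)
Lemma op_sum_near0_expands (V W : normedModType K) (A : nat -> V -> W)
    (F : K -> V -> W) : (forall i, bounded_op (A i)) ->
  (\forall z \near (0 : K), op_sum (fun i => z ^+ i) A (F z)) -> expands 0 A F.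
Proof.
move=> bA /near_rnP[d d0 hd]; split; first by move=> i; case: (bA i).
pose s := d / 2; have s0 : 0 < s by rewrite /s; lra.
have zs : rn (toK rs s) = s by rewrite rn_toK // ltW.
have : op_sum (fun i => toK rs s ^+ i) A (F (toK rs s)).
  by apply: hd; rewrite subr0 zs /s; lra.
move=> /op_sumP /(_ 1 ltr01)[N hN].
have sN n : 0 < s ^+ n by rewrite exprn_gt0.
have big n : (N <= n)%N -> op_le (2 * s^-1 ^+ n) (A n).
  move=> Nn x; have h1 := hN n Nn x; have h2 := hN n.+1 (leqW Nn) x.
  have := rnB (F (toK rs s) x - psum A (toK rs s) n x)
    (F (toK rs s) x - psum A (toK rs s) n.+1 x).
  have pS : psum A (toK rs s) n.+1 x = psum A (toK rs s) n x + toK rs s ^+ n *: A n x.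
    by rewrite /psum big_nat_recr.
  rewrite pS in h2 *; rewrite opprB addrC subrKA addrAC subrr add0r rnZ rnX zs => h3.
  have h4 : s ^+ n * rn (A n x) <= 2 * rn x by lra.
  by rewrite exprVn mulrAC ler_pdivlMr // mulrC.
have [c c0 hc] : exists2 c, 0 <= c & forall i, (i < N)%N -> op_le (c * s^-1 ^+ i) (A i).
  apply: (@uniform_bound N (fun i c => op_le (c * s^-1 ^+ i) (A i))).
    move=> i c c' cc; apply: op_leW; rewrite ler_wpM2r // exprVn invr_ge0 ltW //.
  move=> i _; have /bounded_opP[_ [c c0 hc]] := bA i.
  exists (c * s ^+ i); first by rewrite mulr_ge0 // ltW.
  by rewrite exprVn mulfK // gt_eqF.
exists (c + 2), s^-1, d; split=> //; [lra | by rewrite invr_gt0 | | ].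
  move=> i; have si : 0 <= s^-1 ^+ i by rewrite exprVn invr_ge0 ltW.
  have [/hc|/big] := ltnP i N; apply: op_leW; rewrite ler_wpM2r //; lra.
by move=> h hd'; rewrite add0r; apply: hd; rewrite subr0.
Qed.

(** * Growth of the recursion *)

(* [lia] becomes very slow in the presence of equations between reals. *)
Ltac lia_nat := repeat (match goal with H : ?P |- _ => lazymatch P with
  | is_true (leq _ _) => fail | is_true (andb _ _) => fail
  | is_true (negb _) => fail | nat => fail | @eq nat _ _ => fail
  | _ => clear H end end); lia.

Section Growth.
Variables (B Bb : completeNormedModType K) (L : nat -> B -> Bb).
Hypothesis L_bounded : forall i, bounded_op (L i).
Variables (D : recursion L) (k : nat).
Hypothesis N_stab : forall x j, rN D k.+1 x -> rN D j x.
Hypothesis P_cont : forall i, (1 <= i <= k.+1)%N -> continuous (rP D i).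
Hypothesis Q_cont : forall i, (1 <= i <= k.+1)%N -> continuous (rQ D i).

Local Notation Nc := (rNc D).
Local Notation P := (rP D).
Local Notation Q := (rQ D).
Local Notation Sb := (rSbar D).
Local Notation S := (rS D).
Local Notation E := (rE D).
Local Notation M := (rM D).
Local Notation T := (fun j y => rSinv D j (rQ D j y)).

Let L_linear i : linear (L i). Proof. by case: (L_bounded i). Qed.

Lemma Q_bounded j : (1 <= j)%N -> bounded_op (Q j).
Proof.
move=> j1; have [jk|kj] := leqP j k.+1.
  by split; [exact: Q_linear | apply: Q_cont; rewrite j1].
by apply: bounded_ext (bounded_zeroP _ _) => // y; exact: (Q_stab L_linear N_stab).
Qed.

Lemma P_bounded j : (1 <= j <= k.+1)%N -> bounded_op (P j).
Proof.
by move=> jk; split; [apply: P_linear; case/andP: jk | exact: P_cont].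
Qed.

(** The graph is closed: if u_n -> y and T_j u_n -> x, continuity of P_j keeps x in N_j^c, and
    continuity of S_j and Q_j gives S_j x = Q_j y, so x = T_j y. Boundedness of S_j is a hypothesis
    because it is established by the same column induction as linearity. *)
Lemma T_bounded j : (1 <= j)%N -> bounded_op (S j) -> bounded_op (T j).
Proof.
move=> j1 [lS cS]; have [jk|kj] := leqP j k.+1; last first.
  by apply: bounded_ext (bounded_zeroP _ _) => // y; exact: (T_stab L_linear N_stab).
apply/bounded_opP; split; first exact: T_linear.
apply: closed_graph; first exact: T_linear.
move=> u y x uy Tx.
have Px : P j x = x.
  have PT : (fun n => P j (T j (u n))) @ \oo --> P j x.
    by apply: continuous_cvg Tx; apply: P_cont; rewrite j1.
  have PTE : (fun n => P j (T j (u n))) = (fun n => T j (u n)).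
    by apply/funext => n; rewrite (P_Nc (j := j)) ?eqxx //; exact: T_in.
  by rewrite PTE in PT; exact: (cvg_unique (@norm_hausdorff K B) PT Tx).
have Sx : S j x = Q j y.
  have ST' : (fun n => S j (T j (u n))) @ \oo --> S j x.
    by apply: continuous_cvg Tx; apply: cS.
  have STE : (fun n => S j (T j (u n))) = (fun n => Q j (u n)).
    by apply/funext => n; rewrite ST.
  rewrite STE in ST'.
  have Qy : (fun n => Q j (u n)) @ \oo --> Q j y.
    by apply: continuous_cvg uy; apply: Q_cont; rewrite j1.
  exact: (cvg_unique (@norm_hausdorff K Bb) ST' Qy).
by rewrite -Sx rSinv_def // -Px; apply: P_in.
Qed.

Lemma E_bounded_le i j : (1 <= i <= j)%N ->
  (forall v, (1 <= v <= j)%N -> bounded_op (Sb v) /\ bounded_op (S v)) ->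
  bounded_op (E i j).
Proof.
move=> + bS; move: {2}(j - i)%N (leqnn (j - i)) => d.
elim: d i => [|d IH] i jid /andP[i1 ij].
  have -> : i = j by lia.
  by apply: bounded_ext (bounded_idP _) => x; apply: E_diag; lia.
have [eij|neij] := eqVneq i j; first by apply: IH; lia.
apply: bounded_ext => [x|]; first by apply: rE_def; lia.
apply: bounded_oppP; apply: (bounded_compP (S := T i)).
  by apply: T_bounded => //; apply: (bS i _).2; lia.
apply: bounded_sum_natP => v iv; apply: bounded_compP; first by apply: (bS v _).1; lia.
by apply: IH; lia.
Qed.

Lemma M_bounded_le i j : (1 <= i <= j)%N ->
  (forall v, (1 <= v <= j)%N -> bounded_op (Sb v) /\ bounded_op (S v)) ->
  bounded_op (M i j).
Proof.
elim: i j => [//|i IH] j /andP[_ ij] bS.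
case: i IH ij => [_|i IH] ij.
  apply: bounded_ext => [x|]; first by apply: M1E.
  exact: E_bounded_le.
apply: bounded_ext => [x|]; first exact: rM_def.
apply: bounded_sum_natP => v iv; apply: bounded_compP.
  by apply: IH => [|w wv]; [lia | apply: bS; lia].
by apply: E_bounded_le => //; lia.
Qed.

Lemma Sbar_S_bounded j : (1 <= j)%N -> bounded_op (Sb j) /\ bounded_op (S j).
Proof.
elim/ltn_ind: j => -[//|[|j]] IH _.
  by split; apply: bounded_ext (L_bounded 0%N) => x; rewrite ?rSbar1 ?rS1.
have bSb : bounded_op (Sb j.+2).
  apply: bounded_ext => [x|]; first exact: rSbar_def.
  apply: bounded_sum_natP => i ij; apply: bounded_compP => //.
  by apply: M_bounded_le => [|v vj]; [lia | apply: IH; lia].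
split=> //; apply: bounded_ext => [x|]; first exact: rS_def.
apply: bounded_addP => //; apply: bounded_oppP; apply: bounded_sum_natP => i ij.
by apply: bounded_compP => //; apply: Q_bounded; lia.
Qed.

Lemma Sbar_bounded j : (1 <= j)%N -> bounded_op (Sb j).
Proof. by move=> /Sbar_S_bounded []. Qed.

Lemma S_bounded j : (1 <= j)%N -> bounded_op (S j).
Proof. by move=> /Sbar_S_bounded []. Qed.

Lemma M_bounded i j : (1 <= i <= j)%N -> bounded_op (M i j).
Proof.
by move=> ij; apply: M_bounded_le => // v /andP[v1 _]; exact: Sbar_S_bounded.
Qed.

Lemma T_bounded1 j : (1 <= j)%N -> bounded_op (T j).
Proof. by move=> j1; apply: T_bounded => //; exact: S_bounded. Qed.

(* E_(i, j) for i <= k + 1 < j involves only finitely many operators besides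
   \bar S_j. *)
Lemma E_growth : exists2 e : R, 0 <= e & forall i j x,
  (1 <= i <= k.+1)%N -> (k.+1 < j)%N -> rn (E i j x) <= e * rn (Sb j x).
Proof.
suff h d : exists2 e : R, 0 <= e & forall i j x,
    (1 <= i <= k.+1)%N -> (k.+1 - i < d)%N -> (k.+1 < j)%N ->
    rn (E i j x) <= e * rn (Sb j x).
  have [e e0 he] := h k.+1; exists e => // i j x ik kj; apply: he => //; lia.
elim: d => [|d [e e0 he]]; first by exists 0.
have [s s0 hs] : exists2 s : R, 0 <= s & forall v, (v < k.+2)%N ->
    (1 <= v)%N -> op_le s (Sb v).
  apply: (@uniform_bound _ (fun v s => (1 <= v)%N -> op_le s (Sb v))).
    by move=> v c c' cc h v1; apply: op_leW (h v1).
  move=> [|v] _; first by exists 0.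
  by have /bounded_opP[_ [c c0 hc]] := @Sbar_bounded v.+1 isT; exists c.
have [t t0 ht] : exists2 t : R, 0 <= t & forall v, (v < k.+2)%N ->
    (1 <= v)%N -> op_le t (T v).
  apply: (@uniform_bound _ (fun v s => (1 <= v)%N -> op_le s (T v))).
    by move=> v c c' cc h v1; apply: op_leW (h v1).
  move=> [|v] _; first by exists 0.
  by have /bounded_opP[_ [c c0 hc]] := @T_bounded1 v.+1 isT; exists c.
(* The first summand bounds the new row; the added [e] preserves the bound for the rows already
   treated. *)
exists (t * (1 + k.+2%:R * (s * e)) + e).
  by rewrite addr_ge0 // mulr_ge0 // addr_ge0 // mulr_ge0 // mulr_ge0.
move=> i j x ik kid kj.
have Sx0 := rn_ge0 (Sb j x).
have [kid'|kid'] := ltnP (k.+1 - i) d.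
  apply: le_trans (he _ _ _ ik kid' kj) _; rewrite ler_wpM2r // lerDr.
  by rewrite mulr_ge0 // addr_ge0 // mulr_ge0 // mulr_ge0.
rewrite rE_def; last lia.
rewrite rnN; apply: le_trans (ht i _ _ _) _; [lia | lia | ].
rewrite mulrDl -[X in X <= _]addr0; apply: lerD; last by rewrite mulr_ge0.
rewrite -[leRHS]mulrA ler_wpM2l //.
rewrite big_nat_recr /=; last lia.
rewrite E_diag; last lia.
rewrite addrC; apply: le_trans (rnD _ _) _.
rewrite mulrDl mul1r lerD2l.
rewrite (@big_cat_nat _ _ _ k.+2) /=; [ | lia | lia].
rewrite [X in _ + X]big_nat [X in _ + X]big1 => [|v vj]; last first.
  rewrite (E_stab L_linear N_stab); last lia.
  by apply: lin_map0; apply: (Sbar_linear L_linear); lia.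
rewrite addr0.
apply: le_trans (_ : \sum_(i.+1 <= v < k.+2) s * e * rn (Sb j x) <= _).
  apply: rn_sum_le => v vk; apply: le_trans (hs v _ _ _) _; [lia | lia | ].
  by rewrite -mulrA ler_wpM2l // he //; lia.
rewrite sumr_const_nat -[leLHS]mulr_natl -[leRHS]mulrA.
rewrite ler_wpM2r ?mulr_ge0 // ler_nat; lia.
Qed.

(** In the sum defining M_(i,j) the diagonal term is M_(i-1,j-1). The terms with k + 2 <= v < j
    vanish, and the rest combine [E_growth] with finitely many fixed entries M_(i-1,v-1). *)
Lemma M_growth_step : exists2 u : R, 0 <= u & forall i j x,
  (1 <= i <= k.+1)%N -> (k.+1 < j)%N ->
  rn (M i j x) <= (if i == 1%N then 0 else rn (M i.-1 j.-1 x)) + u * rn (Sb j x).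
Proof.
have [e e0 he] := E_growth.
have [m m0 hm] : exists2 m : R, 0 <= m & forall i, (i < k.+2)%N ->
    forall v, (v < k.+2)%N -> (1 <= i <= v)%N -> op_le m (M i v).
  apply: (@uniform_bound _ (fun i s => forall v, (v < k.+2)%N ->
    (1 <= i <= v)%N -> op_le s (M i v))).
    by move=> i c c' cc h v vk iv; apply: op_leW (h v vk iv).
  move=> i _; apply: (@uniform_bound _ (fun v s => (1 <= i <= v)%N -> op_le s (M i v))).
    by move=> v c c' cc h iv; apply: op_leW (h iv).
  move=> v _; case: (boolP (1 <= i <= v)%N) => [iv|]; last by exists 0.
  by have /bounded_opP[_ [c c0 hc]] := M_bounded iv; exists c.
exists (e + k.+2%:R * (m * e)); first by rewrite addr_ge0 // mulr_ge0 // mulr_ge0.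
move=> i j x ik kj.
have Sx0 := rn_ge0 (Sb j x).
have [->|i1] := eqVneq i 1%N.
  rewrite M1E; last lia.
  rewrite add0r; apply: le_trans (he _ _ _ _ _) _ => //.
  by rewrite ler_wpM2r // lerDl mulr_ge0 // mulr_ge0.
rewrite rM_def; last lia.
rewrite big_nat_recr /=; last lia.
rewrite E_diag; last lia.
rewrite addrC; apply: le_trans (rnD _ _) _; rewrite lerD2l.
rewrite (@big_cat_nat _ _ _ k.+2) /=; [ | lia | lia].
rewrite [X in _ + X]big_nat [X in _ + X]big1 => [|v vj]; last first.
  rewrite (E_stab L_linear N_stab); last lia.
  by apply: lin_map0; apply: (M_linear L_linear); lia.
rewrite addr0.
apply: le_trans (_ : \sum_(i <= v < k.+2) m * e * rn (Sb j x) <= _).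
  apply: rn_sum_le => v vk; apply: le_trans (hm _ _ _ _ _ _) _; [lia | lia | lia | ].
  by rewrite -mulrA ler_wpM2l // he //; lia.
rewrite sumr_const_nat -[leLHS]mulr_natl mulrDl -[leLHS]add0r.
apply: lerD; first by rewrite mulr_ge0.
rewrite -[leRHS]mulrA ler_wpM2r ?mulr_ge0 // ler_nat; lia.
Qed.

Lemma sum_half n : \sum_(1 <= i < n.+1) (2^-1 : R) ^+ i = 1 - 2^-1 ^+ n.
Proof.
elim: n => [|n IH]; first by rewrite big_geq // expr0 subrr.
rewrite big_nat_recr //= IH exprS; lra.
Qed.

Hypothesis L_expands : expands 0 L (op_series L).

(** Strong induction on the column. Sb_j involves column j - 1 in all rows; those below row k + 1
    are moved by the Toeplitz property to row k + 1 of an earlier column, and the powers of the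
    ratio gained in this way outweigh the growth of |L_v|. *)
Lemma M_growth : exists a r : R, [/\ 0 <= a, 0 < r &
  forall i j, (1 <= i <= k.+1)%N -> (i <= j)%N -> op_le (a * r ^+ j) (M i j)].
Proof.
have [_ [c [r [_ [c0 r0 _ Lc _]]]]] := L_expands.
have [u u0 hu] := M_growth_step.
have [l lE] : exists l, l = 1 + r by exists (1 + r).
have l1 : 1 <= l by lra.
have l0 : 0 <= l by lra.
(* For v <= k + 1 the power r^v is at most l^(k+1), and the factor 2^(k+1) makes up for the weight
   2^-v put on the v-th term of Sb_j. *)
have [C CE] : exists C, C = c * l ^+ k.+1 * 2 ^+ k.+1.
  by exists (c * l ^+ k.+1 * 2 ^+ k.+1).
have C0 : 0 <= C by rewrite CE !mulr_ge0 ?exprn_ge0.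
have uC : 0 <= u * C by rewrite mulr_ge0.
(* p >= 2 l gives l^d <= 2^-d p^d for a row d below k + 1, and p >= 1 + u C closes the passage from
   column j - 1 to column j. *)
have [p pE] : exists p, p = 2 * l + 1 + u * C by exists (2 * l + 1 + u * C).
have p1 : 1 <= p by lra.
have p0 : 0 <= p by lra.
have lp : l <= 2^-1 * p by lra.
have half0 : 0 <= (2^-1 : R) by lra.
have [a a0 ha] : exists2 a : R, 0 <= a & forall i, (i < k.+2)%N ->
    forall v, (v < k.+2)%N -> (1 <= i <= v)%N -> op_le a (M i v).
  apply: (@uniform_bound _ (fun i s => forall v, (v < k.+2)%N ->
    (1 <= i <= v)%N -> op_le s (M i v))).
    by move=> i b b' bb h v vk iv; apply: op_leW (h v vk iv).
  move=> i _; apply: (@uniform_bound _ (fun v s => (1 <= i <= v)%N -> op_le s (M i v))).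
    by move=> v b b' bb h iv; apply: op_leW (h iv).
  move=> v _; case: (boolP (1 <= i <= v)%N) => [iv|]; last by exists 0.
  by have /bounded_opP[_ [b b0 hb]] := M_bounded iv; exists b.
exists a, p; split=> //; first by lra.
move=> i j; elim/ltn_ind: j i => j IH i ik ij.
have [jk|kj] := leqP j k.+1.
  have hij : op_le a (M i j) by apply: ha; lia_nat.
  apply: op_leW hij.
  by rewrite -[leLHS]mulr1 ler_wpM2l // exprn_ege1.
move=> x; have x0 := rn_ge0 x.
have jE : j = j.-1.+1 by lia_nat.
have [w wE] : exists w, w = a * p ^+ j.-1 * rn x by exists (a * p ^+ j.-1 * rn x).
have w0 : 0 <= w by rewrite wE !mulr_ge0 // exprn_ge0.
have hS : rn (Sb j x) <= C * w.
  rewrite rSbar_def; last lia_nat.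
  apply: le_trans (_ : \sum_(1 <= v < j) C * w * 2^-1 ^+ v <= _); last first.
    rewrite -mulr_sumr [X in \sum_(_ <= _ < X) _]jE sum_half -[leRHS]mulr1.
    by rewrite ler_wpM2l ?mulr_ge0 // gerBl exprn_ge0.
  apply: rn_sum_le => v vj; apply: le_trans (Lc v _) _.
  have cv : 0 <= c * r ^+ v by rewrite mulr_ge0 // exprn_ge0 // ltW.
  have rl d : r ^+ d <= l ^+ d.
    by rewrite lerXn2r ?nnegrE // ?ltW // lE; lra.
  have [vk|kv] := leqP v k.+1.
    have hM : rn (M v j.-1 x) <= w by rewrite wE; apply: IH; lia_nat.
    apply: le_trans (ler_wpM2l cv hM) _.
    rewrite [leRHS]mulrAC ler_wpM2r // CE -!mulrA ler_wpM2l //.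
    rewrite -[leLHS]mulr1; apply: ler_pM => //; first by rewrite exprn_ge0 // ltW.
      by apply: le_trans (rl v) _; rewrite ler_weXn2l.
    rewrite exprVn ler_pdivlMr ?exprn_gt0 // mul1r ler_weXn2l //; lra.
  have [d vE] : exists d, v = (k.+1 + d)%N by exists (v - k.+1)%N; lia_nat.
  have MvE : M v j.-1 x = M k.+1 (j.-1 - d) x.
    have := M_shift L_linear N_stab d (j.-1 - v) x.
    have -> : (k.+1 + d + (j.-1 - v) = j.-1)%N by lia_nat.
    by rewrite -vE => ->; congr (M _ _ x); lia_nat.
  have hM : rn (M v j.-1 x) <= a * p ^+ (j.-1 - d) * rn x.
    by rewrite MvE; apply: IH; lia_nat.
  apply: le_trans (ler_wpM2l cv hM) _.
  have -> : C * w * 2^-1 ^+ v = c * l ^+ k.+1 * (2^-1 * p) ^+ d *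
      (a * p ^+ (j.-1 - d) * rn x).
    have h2 : (2 : R) ^+ k.+1 * 2^-1 ^+ v = 2^-1 ^+ d.
      by rewrite vE exprD mulrA -exprMn divff // expr1n mul1r.
    have hp : p ^+ j.-1 = p ^+ d * p ^+ (j.-1 - d).
      by rewrite -exprD subnKC //; lia_nat.
    rewrite exprMn CE wE hp -h2.
    move: (2 ^+ k.+1) (2^-1 ^+ v) (p ^+ d) (p ^+ _) (l ^+ _) => a1 a2 a3 a4 a5.
    by ring.
  apply: ler_wpM2r; first by rewrite !mulr_ge0 // exprn_ge0.
  rewrite vE exprD -!mulrA ler_wpM2l //.
  apply: ler_pM; rewrite ?exprn_ge0 ?(ltW r0) //.
  apply: le_trans (rl d) _; rewrite lerXn2r // nnegrE //; lra.
apply: le_trans (hu i j x ik kj) _.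
have hM : (if i == 1%N then 0 else rn (M i.-1 j.-1 x)) <= w.
  case: eqP => // /eqP i1; rewrite wE; apply: IH; lia_nat.
have -> : a * p ^+ j * rn x = p * w.
  by rewrite {1}jE exprS wE; move: (p ^+ _) => b; ring.
have h1 := ler_wpM2l u0 hS.
have h2 : 0 <= l * w by rewrite mulr_ge0.
rewrite pE !mulrDl mul1r; rewrite -mulrA; lra.
Qed.

Lemma phi_coefE i x : phi_coef D k i x = M k.+1 (k.+1 + i) x.
Proof. by case: i => [|i] //=; rewrite addn0 M_diag. Qed.

Lemma phi_expands : expands 0 (phi_coef D k) (phi D k).
Proof.
have [a [r [a0 r0 hM]]] := M_growth.
have ar0 : 0 <= a * r ^+ k.+1 by rewrite mulr_ge0 // exprn_ge0 // ltW.
have g : geo_le (a * r ^+ k.+1) r (phi_coef D k).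
  move=> i x; rewrite phi_coefE -[a * _ * _]mulrA -exprD.
  by apply: (hM _ _ _ _ x); lia.
split.
  move=> i; apply: linear_extP => [x|]; first exact: phi_coefE.
  by apply: (M_linear L_linear); lia.
exists (a * r ^+ k.+1), r, (2^-1 / r); split=> //.
  by rewrite divr_gt0 // invr_gt0.
move=> h hd; rewrite add0r /phi; apply: (op_sum_series ar0 (ltW r0) g).
by rewrite mulrC -ler_pdivlMr // ltW.
Qed.

Lemma S_expands :
  expands 0 (fun i => S i.+1) (fun z => op_series L z \o phi D k z).
Proof.
apply: (expands_ext (d := 1) _ ltr01 _ (expands_comp L_expands phi_expands)) => //.
move=> m x; rewrite -(L_phi L_linear N_stab) /cauchy_prod.
by apply: eq_big_nat => i im; rewrite phi_coefE.
Qed.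

Lemma psi_expands : expands 0 (psi_coef D k) (psi D k).
Proof.
have [_ [c [r [_ [c0 r0 _ Sc _]]]]] := S_expands.
have [t t0 ht] : exists2 t : R, 0 <= t & forall v, (v < k.+2)%N ->
    (1 <= v)%N -> op_le t (T v).
  apply: (@uniform_bound _ (fun v s => (1 <= v)%N -> op_le s (T v))).
    by move=> v b b' bb h v1; apply: op_leW (h v1).
  move=> [|v] _; first by exists 0.
  by have /bounded_opP[_ [b b0 hb]] := @T_bounded1 v.+1 isT; exists b.
(* (1 + r)^k dominates the shifts r^(j-1) for j <= k + 1; the final 1 covers the coefficient I at
   index 0. *)
have [C CE] : exists C, C = k.+1%:R * (c * (1 + r) ^+ k * t) + 1.
  by exists (k.+1%:R * (c * (1 + r) ^+ k * t) + 1).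
have C1 : 0 <= k.+1%:R * (c * (1 + r) ^+ k * t).
  by rewrite !mulr_ge0 // exprn_ge0 //; lra.
have C0 : 0 <= C by lra.
have g : geo_le C r (psi_coef D k).
  move=> [|i] y /=; have y0 := rn_ge0 y.
    by rewrite expr0 mulr1 -[leLHS]mul1r ler_wpM2r // CE; lra.
  apply: le_trans (_ : \sum_(1 <= j < k.+2) c * (1 + r) ^+ k * t * r ^+ i.+1 * rn y <= _).
    apply: rn_sum_le => j jk.
    have -> : (i.+1 + j = (i + j).+1)%N by lia_nat.
    apply: le_trans (Sc _ _) _.
    have ri n : 0 <= r ^+ n by rewrite exprn_ge0 // ltW.
    have := ht j _ _ y; move=> /(_ ltac:(lia_nat) ltac:(lia_nat)) hty.
    apply: le_trans (ler_wpM2l (mulr_ge0 c0 (ri _)) hty) _.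
    have -> : (i + j = i.+1 + j.-1)%N by lia_nat.
    rewrite exprD.
    have : r ^+ j.-1 <= (1 + r) ^+ k.
      apply: le_trans (_ : (1 + r) ^+ j.-1 <= _).
        by rewrite lerXn2r ?nnegrE //; lra.
      by rewrite ler_weXn2l //; [lra | lia_nat].
    move: (ri i.+1) (ri j.-1); move: (r ^+ i.+1) (r ^+ j.-1) ((1 + r) ^+ k).
    move=> a b e a_0 b_0 be.
    have -> : c * (a * b) * (t * rn y) = c * b * (t * a * rn y) by ring.
    have -> : c * e * t * a * rn y = c * e * (t * a * rn y) by ring.
    by rewrite ler_wpM2r ?mulr_ge0 // ler_wpM2l.
  rewrite sumr_const_nat subn1 -[leLHS]mulr_natl /= CE.
  rewrite mulrDl mulrDl -[leLHS]addr0.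
  have ri : 0 <= r ^+ i.+1 by rewrite exprn_ge0 // ltW.
  apply: lerD; last by rewrite mul1r mulr_ge0.
  by rewrite !mulrA.
split.
  move=> [|i] //=.
  apply: (@linear_sum_natP _ _ _ 1 k.+2
    (fun j y => S (i.+1 + j) (rSinv D j (rQ D j y)))) => j jk.
  apply: (@linear_compP _ _ _ _ _ (T j)).
    by apply: (S_linear L_linear); lia_nat.
  by apply: T_linear; [lia_nat | apply: (S_linear L_linear); lia_nat].
exists C, r, (2^-1 / r); split=> //.
  by rewrite divr_gt0 // invr_gt0.
move=> h hd; rewrite add0r /psi; apply: (op_sum_series C0 (ltW r0) g).
by rewrite mulrC -ler_pdivlMr // ltW.
Qed.

End Growth.

(** * The diagonal family *)

Section Diagonal.
Variables (B Bb : completeNormedModType K) (L : nat -> B -> Bb).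
Hypothesis L_linear : forall i, linear (L i).
Variables (D : recursion L) (k : nat).

Local Notation N := (rN D).
Local Notation Nc := (rNc D).
Local Notation P := (rP D).
Local Notation Q := (rQ D).
Local Notation S := (rS D).
Local Notation T := (fun j y => rSinv D j (rQ D j y)).
Local Notation Delta := (Delta D k).
Local Notation Delta_inv := (Delta_inv D k).
Local Notation sumP := (sumP D k).
Local Notation sumQ := (sumQ D k).

Let lS j : (1 <= j)%N -> linear (S j). Proof. exact: S_linear. Qed.

Lemma S_P_in_R j x : (1 <= j)%N -> rR D j (S j (P j x)).
Proof. by move=> j1; apply: S_in_R => //; apply: Nc_sub => //; apply: P_in. Qed.

Lemma sum_pick (V : nmodType) i (F : nat -> V) : (1 <= i <= k.+1)%N ->
  \sum_(1 <= j < k.+2) (if i == j then F j else 0) = F i.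
Proof.
move=> ik; rewrite (bigD1_seq i) ?iota_uniq ?mem_index_iota //= eqxx.
by rewrite big1 ?addr0 // => j /negPf ji; rewrite eq_sym ji.
Qed.

Lemma Q_Delta i z x : (1 <= i <= k.+1)%N -> Q i (Delta z x) = z ^+ i.-1 *: S i (P i x).
Proof.
move=> ik; have i1 : (1 <= i)%N by case/andP: ik.
rewrite (lin_map_sum (Q_linear D i1)).
rewrite -[RHS](sum_pick (fun j => z ^+ j.-1 *: S j (P j x)) ik).
apply: eq_big_nat => j jk; have j1 : (1 <= j)%N by case/andP: jk.
rewrite (lin_mapZ (Q_linear D i1)) (Q_R (j := j)) //; last exact: S_P_in_R.
by case: eqP => // _; rewrite scaler0.
Qed.

Lemma P_Delta_inv i z y : (1 <= i <= k.+1)%N -> P i (Delta_inv z y) = z ^- i.-1 *: T i y.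
Proof.
move=> ik; have i1 : (1 <= i)%N by case/andP: ik.
rewrite (lin_map_sum (P_linear D i1)).
rewrite -[RHS](sum_pick (fun j => z ^- j.-1 *: T j y) ik).
apply: eq_big_nat => j jk; have j1 : (1 <= j)%N by case/andP: jk.
rewrite (lin_mapZ (P_linear D i1)) (P_Nc (j := j)) //; last first.
  by apply: T_in => //; apply: lS.
by case: eqP => // _; rewrite scaler0.
Qed.

Lemma P_sumP i x : (1 <= i <= k.+1)%N -> P i (sumP x) = P i x.
Proof.
move=> ik; have i1 : (1 <= i)%N by case/andP: ik.
rewrite (lin_map_sum (P_linear D i1)) -[RHS](sum_pick (fun j => P j x) ik).
apply: eq_big_nat => j jk; have j1 : (1 <= j)%N by case/andP: jk.
by rewrite (P_Nc (j := j)) //; apply: P_in.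
Qed.

Lemma Q_sumQ i y : (1 <= i <= k.+1)%N -> Q i (sumQ y) = Q i y.
Proof.
move=> ik; have i1 : (1 <= i)%N by case/andP: ik.
rewrite (lin_map_sum (Q_linear D i1)) -[RHS](sum_pick (fun j => Q j y) ik).
apply: eq_big_nat => j jk; have j1 : (1 <= j)%N by case/andP: jk.
by rewrite (Q_R (j := j)) //; apply: Q_in.
Qed.

Lemma Delta_Delta_inv z y : z != 0 -> Delta z (Delta_inv z y) = sumQ y.
Proof.
move=> z0; apply: eq_big_nat => j jk; have j1 : (1 <= j)%N by case/andP: jk.
rewrite P_Delta_inv // (lin_mapZ (lS j1)) scalerA divff ?expf_neq0 // scale1r.
exact: (ST y j1 (lS j1)).
Qed.

Lemma Delta_inv_Delta z x : z != 0 -> Delta_inv z (Delta z x) = sumP x.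
Proof.
move=> z0; apply: eq_big_nat => j jk; have j1 : (1 <= j)%N by case/andP: jk.
rewrite Q_Delta // -(lin_mapZ (lS j1)) rSinv_def //; last first.
  by apply: subspaceZ; [exact: Nc_subspace | exact: P_in].
by rewrite scalerA mulVf ?expf_neq0 // scale1r.
Qed.

Lemma Delta_sumP z x : Delta z (sumP x) = Delta z x.
Proof. by apply: eq_big_nat => j jk; rewrite P_sumP. Qed.

Lemma Delta_inv_sumQ z y : Delta_inv z (sumQ y) = Delta_inv z y.
Proof. by apply: eq_big_nat => j jk; rewrite Q_sumQ. Qed.

Lemma sumQ_Delta z x : sumQ (Delta z x) = Delta z x.
Proof. by apply: eq_big_nat => j jk; rewrite Q_Delta. Qed.

Lemma sumP_sumP x : sumP (sumP x) = sumP x.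
Proof. by apply: eq_big_nat => j jk; rewrite P_sumP. Qed.

Lemma sumQ_sumQ y : sumQ (sumQ y) = sumQ y.
Proof. by apply: eq_big_nat => j jk; rewrite Q_sumQ. Qed.

Lemma Delta_eq0 z x : z != 0 -> Delta z x = 0 <-> N k.+1 x.
Proof.
move=> z0; split=> [D0|Nx].
  apply: N_mem => i ik; have i1 : (1 <= i)%N by case/andP: ik.
  have := Q_Delta z x ik; rewrite D0 (lin_map0 (Q_linear D i1)) => /esym/eqP.
  rewrite scaler_eq0 (negPf (expf_neq0 _ z0)) /= => /eqP SP0.
  by rewrite -(rSinv_def i1 (P_in D x i1)) SP0 -(lin_map0 (lS i1)) rSinv_def //;
    apply: subspace0; apply: Nc_subspace.
rewrite /Defs.Delta big_nat big1 // => j jk; have j1 : (1 <= j)%N by case/andP: jk.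
by rewrite (P_N (j := k.+1)) // (lin_map0 (lS j1)) scaler0.
Qed.

Definition Delta_coef (i : nat) : B -> Bb :=
  if (i <= k)%N then fun x => S i.+1 (P i.+1 x) else fun=> 0.

(** The coefficients of z^k Delta^-1(z): the factor z^k reverses the order of the T_j, so the
    leading one is T_(k+1). *)
Definition Delta_inv_coef (i : nat) : Bb -> B :=
  if (i <= k)%N then T (k.+1 - i)%N else fun=> 0.

Hypothesis N_stab : forall x j, N k.+1 x -> N j x.

(** By [psi_S] the left side is the sum of S_(m+1) P_(i+1) x over i <= min(m, k), and by [S_sumP]
    the right side is the sum over i <= k. The extra terms vanish because S_(m+1) is zero on
    N_(i+1)^c for i > m. *)
Lemma psi_Delta_coef m x : cauchy_prod (psi_coef D k) Delta_coef m x = S m.+1 x.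
Proof.
pose g i := if (i <= k)%N then S m.+1 (P i.+1 x) else 0.
have gm i : (m < i)%N -> g i = 0.
  by move=> mi; rewrite /g; case: leqP => // ik; apply: S_P0; lia.
have gk i : (k < i)%N -> g i = 0 by move=> ki; rewrite /g leqNgt ki.
have gE n : (n <= m + k)%N -> (forall i, (n < i)%N -> g i = 0) ->
    \sum_(0 <= i < n.+1) g i = \sum_(0 <= i < (m + k).+1) g i.
  move=> nmk gn; rewrite [RHS](@big_cat_nat _ _ _ n.+1) //=.
  rewrite [X in _ = _ + X]big_nat [X in _ = _ + X]big1 ?addr0 // => i ni.
  by apply: gn; case/andP: ni.
transitivity (\sum_(0 <= i < m.+1) g i).
  rewrite [RHS]big_nat_rev /= add0n /cauchy_prod; apply: eq_big_nat => i im.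
  have -> : (m.+1 - i.+1 = m - i)%N by lia.
  rewrite /g /Delta_coef; case: leqP => mik; last first.
    case: i {im} mik => [|i] mik //=.
    rewrite big_nat big1 // => j jk; have j1 : (1 <= j)%N by case/andP: jk.
    have T0 := lin_map0 (T_linear j1 (lS j1)); rewrite /= in T0.
    by rewrite T0 (lin_map0 (lS _)) //; lia.
  case: i im mik => [|i] im mik; first by rewrite subn0.
  rewrite /= (psi_S L_linear); [congr (S _ _) | | apply: P_in => //]; lia.
rewrite (S_sumP L_linear N_stab) // big_add1 /=.
transitivity (\sum_(0 <= i < k.+1) g i); last first.
  by apply: eq_big_nat => i ik; rewrite /g -ltnS; case/andP: ik => _ ->.
by rewrite (gE m _ gm) ?(gE k _ gk) ?leq_addr ?leq_addl.
Qed.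

Hypothesis S_bounded : forall j, (1 <= j)%N -> bounded_op (S j).
Hypothesis T_bounded : forall j, (1 <= j)%N -> bounded_op (T j).
Hypothesis P_bounded : forall j, (1 <= j <= k.+1)%N -> bounded_op (P j).
Hypothesis Q_bounded : forall j, (1 <= j <= k.+1)%N -> bounded_op (Q j).

Lemma Delta_expands : expands 0 Delta_coef Delta.
Proof.
apply: (@expands_poly _ _ k.+1).
- move=> i; rewrite /Delta_coef; case: leqP => ik; last exact: bounded_zeroP.
  by apply: bounded_compP; [exact: S_bounded | apply: P_bounded; lia].
- by move=> i ki x; rewrite /Delta_coef leqNgt ki.
- move=> h x; rewrite add0r /Defs.Delta big_add1 /=; apply: eq_big_nat => i ik.
  by rewrite /Delta_coef -ltnS; case/andP: ik => _ ->.
Qed.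

Lemma Delta_inv_coef_bounded i : bounded_op (Delta_inv_coef i).
Proof.
rewrite /Delta_inv_coef; case: leqP => ik; last exact: bounded_zeroP.
by apply: T_bounded; lia.
Qed.

Lemma Delta_inv_coef_expands :
  expands 0 Delta_inv_coef (fun z => psum Delta_inv_coef z k.+1).
Proof.
apply: (@expands_poly _ _ k.+1).
- exact: Delta_inv_coef_bounded.
- by move=> i ki x; rewrite /Delta_inv_coef leqNgt ki.
- by move=> h x; rewrite add0r.
Qed.

(** For k = 0 no negative power occurs, so the identity extends to z = 0, as a pole of order 0
    requires. *)
Lemma Delta_invE z y : (z != 0) || (k == 0%N) ->
  Delta_inv z y = z ^- k *: psum Delta_inv_coef z k.+1 y.
Proof.
move=> zk; rewrite /psum scaler_sumr big_nat_rev /= add0n /Defs.Delta_inv big_add1 /=.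
apply: eq_big_nat => i ik; have ik' : (i <= k)%N by case/andP: ik.
have -> : (k.+1 - i.+1 = k - i)%N by lia.
rewrite /Delta_inv_coef leq_subr scalerA.
have -> : (k.+1 - (k - i) = i.+1)%N by lia.
congr (_ *: _); case/orP: zk => [z0|/eqP k0].
  apply: (mulfI (expf_neq0 i z0)); rewrite divff ?expf_neq0 //.
  by rewrite mulrCA -exprD subnKC // mulVf // expf_neq0.
have i0 : i = 0%N by lia.
by rewrite i0 k0 subn0 expr0 mulr1.
Qed.

Lemma Delta_inv_bounded z : bounded_op (Delta_inv z).
Proof.
apply: bounded_sum_natP => j jk.
apply: (bounded_compP (S := fun x => _ *: x) (T := T j)).
  exact: bounded_scaleP.
by apply: T_bounded; case/andP: jk.
Qed.

Lemma Delta_inv_expands z0 : z0 != 0 -> exists A, expands z0 A Delta_inv.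
Proof.
move=> z00.
have h j : exists A, (1 <= j)%N -> expands z0 A (fun z y => z ^- j.-1 *: T j y).
  case: (posnP j) => [->|j1]; first by exists (fun _ _ => 0).
  have [A hA] := expands_scalar_inv B j.-1 z00.
  eexists=> _; apply: (expands_comp hA (expands_cst z0 (T_bounded j1))).
have [A hA] := choice h.
by apply: (expands_sum (A := A)) => j /andP[j1 _]; apply: hA.
Qed.

Lemma sumP_bounded : bounded_op sumP.
Proof. by apply: bounded_sum_natP => j jk; exact: P_bounded. Qed.

Lemma sumQ_bounded : bounded_op sumQ.
Proof. by apply: bounded_sum_natP => j jk; exact: Q_bounded. Qed.

Lemma Delta_generalized_inverse z : z != 0 ->
  generalized_inverse (Delta z) (Delta_inv z).
Proof.
move=> z0; split=> [|x|y]; first exact: Delta_inv_bounded.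
- by rewrite Delta_inv_Delta // Delta_sumP.
- by rewrite Delta_Delta_inv // Delta_inv_sumQ.
Qed.

End Diagonal.

(** * Laurent expansions and analytic families *)

Lemma op_sum_scale (V W : normedModType K) (b : K) (a : nat -> K)
    (A : nat -> V -> W) (T : V -> W) :
  op_sum a A T -> op_sum (fun i => b * a i) A (fun x => b *: T x).
Proof.
move=> hT e e0; have b1 : 0 < `|b| + 1 by rewrite ltr_wpDl.
have [N _ hN] := hT (e / (`|b| + 1)) (divr_gt0 e0 b1); exists N => // n Nn x.
under eq_bigr do rewrite -scalerA.
rewrite -scaler_sumr -scalerBr normrZ.
apply: le_trans (ler_wpM2l _ (hN n Nn x)) _ => //.
rewrite mulrA ler_wpM2r // mulrCA ler_piMr ?(ltW e0) // ler_pdivrMr // mul1r.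
by rewrite lerDl.
Qed.

Lemma expands_pole (V W : normedModType K) (k : nat) (A : nat -> V -> W)
    (F G : K -> V -> W) : expands 0 A G -> (exists x, A 0%N x != 0) ->
  (\forall z \near (0 : K), (z != 0) || (k == 0%N) ->
     F z =1 fun x => z ^- k *: G z x) ->
  pole_of_order k F.
Proof.
move=> GA A0 FG; exists A; split=> //; first exact: (expands_coef_bounded GA).
have GN := expands_near GA; near=> z => zk.
have -> : F z = fun x => z ^- k *: G z x.
  by apply/funext => x; move: zk x; near: z.
have hz : op_sum (fun i => (z - 0) ^+ i) A (G z) by near: z.
by rewrite subr0 in hz; exact: (op_sum_scale (z ^- k) hz).
Unshelve. all: by end_near. Qed.

Lemma near0_rn (Pr : K -> Prop) :
  (exists2 d : R, 0 < d & forall h, rn h < d -> Pr (0 + h)) ->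
  \forall z \near (0 : K), Pr z.
Proof.
move=> [d d0 hd]; apply/near_rnP; exists d => // z.
by rewrite subr0 => /hd; rewrite add0r.
Qed.

Lemma expands0_near (V W : normedModType K) (A : nat -> V -> W)
    (F : K -> V -> W) : expands 0 A F ->
  \forall z \near (0 : K), op_sum (fun i => z ^+ i) A (F z).
Proof.
move=> /expands_near; apply: filterS => z hz.
by rewrite subr0 in hz.
Qed.

Lemma expands_analytic_on (V W : normedModType K) (U : set K) (F : K -> V -> W) :
  (forall z, U z -> exists A, expands z A F) -> analytic_on U F.
Proof.
move=> UF z0 /UF[A FA]; exists A; last exact: (expands_near FA).
exact: (expands_coef_bounded FA).
Qed.

(** * The normal form at a point and on a disc *)

Section Main.
Variables (B Bb : completeNormedModType K) (L : nat -> B -> Bb).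
Hypothesis L_bounded : forall i, bounded_op (L i).
Hypothesis L_expands : expands 0 L (op_series L).
Variables (D : recursion L) (k : nat).
Hypothesis N_stab : forall x j, rN D k.+1 x -> rN D j x.
Hypothesis Nc_neq0 : exists2 x, rNc D k.+1 x & x != 0.
Hypothesis P_cont : forall i, (1 <= i <= k.+1)%N -> continuous (rP D i).
Hypothesis Q_cont : forall i, (1 <= i <= k.+1)%N -> continuous (rQ D i).

Local Notation Lz := (op_series L).
Local Notation phi := (phi D k).
Local Notation psi := (psi D k).
Local Notation Delta := (Delta D k).
Local Notation Delta_inv := (Delta_inv D k).
Local Notation sumP := (sumP D k).
Local Notation sumQ := (sumQ D k).
Local Notation sumNc := (sum_spaces 1 k.+1 (rNc D)).
Local Notation sumR := (sum_spaces 1 k.+1 (rR D)).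

Let L_linear i : linear (L i). Proof. by case: (L_bounded i). Qed.
Let S_bd j : (1 <= j)%N -> bounded_op (rS D j).
Proof. exact: (S_bounded L_bounded N_stab P_cont Q_cont). Qed.
Let T_bd j : (1 <= j)%N -> bounded_op (fun y => rSinv D j (rQ D j y)).
Proof. exact: (T_bounded1 L_bounded N_stab P_cont Q_cont). Qed.
Let P_bd j : (1 <= j <= k.+1)%N -> bounded_op (rP D j).
Proof. exact: (P_bounded P_cont). Qed.
Let Q_bd j : (1 <= j <= k.+1)%N -> bounded_op (rQ D j).
Proof. by case/andP=> j1 _; exact: (Q_bounded L_bounded N_stab Q_cont). Qed.
Let phi_exp := phi_expands L_bounded N_stab P_cont Q_cont L_expands.
Let psi_exp := psi_expands L_bounded N_stab P_cont Q_cont L_expands.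
Let S_exp := S_expands L_bounded N_stab P_cont Q_cont L_expands.

Section OnePoint.
Variables (z : K) (phi_inv : B -> B) (psi_inv : Bb -> Bb).
Hypothesis phiK : cancel (phi z) phi_inv.
Hypothesis phi_invK : cancel phi_inv (phi z).
Hypothesis psiK : cancel (psi z) psi_inv.
Hypothesis psi_invK : cancel psi_inv (psi z).
Hypothesis phi_bd : bounded_op (phi z).
Hypothesis psi_bd : bounded_op (psi z).
Hypothesis phi_inv_bd : bounded_op phi_inv.
Hypothesis psi_inv_bd : bounded_op psi_inv.
Hypothesis Lz_bd : bounded_op (Lz z).
Hypothesis L_phi_psi : forall x, psi z (Delta z x) = Lz z (phi z x).
Let Linv := phi z \o Delta_inv z \o psi_inv.

(** The factorization of L(z) through the diagonal operator; the kernel, the range and the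
    generalized inverse at a fixed z are transported along it. *)
Lemma Lz_psi x : Lz z x = psi z (Delta z (phi_inv x)).
Proof. by rewrite L_phi_psi phi_invK. Qed.

Lemma psi_inv_L_phi : psi_inv \o Lz z \o phi z =1 Delta z.
Proof. by move=> x /=; rewrite -L_phi_psi psiK. Qed.

Lemma Linv_bounded : bounded_op Linv.
Proof.
apply: (bounded_compP (S := phi z)) => //.
by apply: (bounded_compP (S := Delta_inv z)) => //; exact: Delta_inv_bounded.
Qed.

Hypothesis z0 : z != 0.

Lemma Linv_L : Linv \o Lz z =1 phi z \o sumP \o phi_inv.
Proof. by move=> x; rewrite /Linv /= Lz_psi psiK Delta_inv_Delta. Qed.

Lemma L_Linv : Lz z \o Linv =1 psi z \o sumQ \o psi_inv.
Proof. by move=> x; rewrite /Linv /= Lz_psi phiK Delta_Delta_inv. Qed.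

Lemma Linv_generalized_inverse : generalized_inverse (Lz z) Linv.
Proof.
split; first exact: Linv_bounded.
- move=> x; apply: eq_trans (L_Linv (Lz z x)) _.
  by rewrite /= (Lz_psi x) psiK sumQ_Delta.
- move=> y; apply: eq_trans (Linv_L (Linv y)) _.
  rewrite /Linv /= phiK; congr (phi z _).
  by rewrite -(Delta_inv_Delta L_linear D k _ z0) Delta_Delta_inv // Delta_inv_sumQ.
Qed.

Lemma kernel_Lz : op_kernel (Lz z) = phi z @` rN D k.+1.
Proof.
have psi0 : psi z 0 = 0 by apply: lin_map0; case: psi_bd.
apply/seteqP; split=> [x|_ [x Nx <-]]; rewrite /op_kernel /=.
  rewrite Lz_psi => h; exists (phi_inv x) => //.
  apply/(Delta_eq0 L_linear D k _ z0); apply: (can_inj psiK).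
  by rewrite h psi0.
by rewrite -L_phi_psi ((Delta_eq0 L_linear D k _ z0).2 Nx) psi0.
Qed.

Lemma range_Lz : range (Lz z) = psi z @` sumR.
Proof.
apply/seteqP; split=> [_ [x _ <-]|_ [y /sum_R yR <-]].
  exists (Delta z (phi_inv x)); last by rewrite -Lz_psi.
  by apply/sum_R; exact: sumQ_Delta.
exists (phi z (Delta_inv z y)) => //.
by rewrite -L_phi_psi Delta_Delta_inv //; congr (psi z _).
Qed.

Lemma Linv_L_projection : projection_onto (Linv \o Lz z) (phi z @` sumNc).
Proof.
split; first exact: (bounded_compP Linv_bounded Lz_bd).
- by move=> x; rewrite !Linv_L /= phiK sumP_sumP.
- apply/seteqP; split=> [_ [x _ <-]|_ [x /sum_Nc xN <-]].
    rewrite Linv_L /=; exists (sumP (phi_inv x)) => //.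
    by apply/sum_Nc; exact: sumP_sumP.
  by exists (phi z x) => //; rewrite Linv_L /= phiK; congr (phi z _).
Qed.

Lemma L_Linv_projection : projection_onto (Lz z \o Linv) (range (Lz z)).
Proof.
split; first exact: (bounded_compP Lz_bd Linv_bounded).
- by move=> y; rewrite !L_Linv /= psiK sumQ_sumQ.
- apply/seteqP; split=> [_ [y _ <-]|_ [x _ <-]] /=; first by exists (Linv y).
  by exists (Lz z x) => //; case: Linv_generalized_inverse => _ + _; apply.
Qed.

End OnePoint.

(** Stabilization enters only through [N_stab] and [Nc_neq0]. Finitely many properties hold near 0,
    so a single disc serves for all of them. *)
Lemma near_identity_normal_form :
  exists (U : set K) (phi_inv : K -> B -> B) (psi_inv : K -> Bb -> Bb),
    let Lz := op_series L in
    let Sz := fun z => Lz z \o phi z in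
    let Linv := fun z => phi z \o Delta_inv z \o psi_inv z in
    let sumNc := sum_spaces 1 k.+1 (rNc D) in
    let sumR := sum_spaces 1 k.+1 (rR D) in
    [/\ open U, U 0 & power_series_on U L Lz] /\
    ([/\ near_identity U phi phi_inv,
         power_series_on U (phi_coef D k) phi,
         analytic_on U Sz &
         power_series_on U (fun i => rS D i.+1) Sz]
     /\
     (forall i, (1 <= i <= k.+1)%N ->
        [/\ rS D i @` sum_spaces 0 i.-1 (rNc D) `<=` rRc D i.-1,
            rS D i @` rNc D i = rR D i &
            rS D i @` rN D i = [set 0]]) /\
     (forall l, (2 <= l)%N ->
        range (rS D (k + l)) `<=` rRc D k.+1 /\
        rS D (k + l) @` rN D k.+1 = [set 0])) /\
    [/\ near_identity U psi psi_inv,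
        power_series_on U (psi_coef D k) psi &
        forall z, U z -> psi_inv z \o Lz z \o phi z =1 Delta z] /\
    [/\ forall z, U z -> z != 0 -> op_kernel (Lz z) = phi z @` rN D k.+1,
        forall z, U z -> z != 0 -> range (Lz z) = psi z @` sumR,
        analytically_embedded U (fun z => op_kernel (Lz z))
          (fun z => phi z @` rN D k.+1) &
        analytically_embedded U (fun z => range (Lz z))
          (fun z => psi z @` sumR)] /\
    [/\ forall z, z != 0 -> generalized_inverse (Delta z) (Delta_inv z),
        pole_of_order k (Delta_inv),
        forall z, U z -> z != 0 -> generalized_inverse (Lz z) (Linv z),
        analytic_on (U `\ 0) Linv &
        pole_of_order k Linv] /\
    [/\ forall z, U z -> z != 0 ->
          Linv z \o Lz z =1 phi z \o sumP \o phi_inv z,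
        forall z, U z -> z != 0 ->
          Lz z \o Linv z =1 psi z \o sumQ \o psi_inv z,
        forall z, U z -> z != 0 ->
          projection_onto (Linv z \o Lz z) (phi z @` sumNc) &
        forall z, U z -> z != 0 ->
          projection_onto (Lz z \o Linv z) (range (Lz z)) /\
          range (Lz z) = psi z @` sumR] /\
    continues_to_0 U (fun z => Linv z \o Lz z) sumP /\
    continues_to_0 U (fun z => Lz z \o Linv z) sumQ.
Proof.
have bT := T_bd; have bS := S_bd; have bP := P_bd; have bQ := Q_bd.
have [Np [phi_inv [Np0 phii_exp phi_can]]] := expands_inverse phi_exp (fun=> erefl).
have [Nq [psi_inv [Nq0 psii_exp psi_can]]] := expands_inverse psi_exp (fun=> erefl).
have Delta_exp : expands 0 (Delta_coef D k) Delta by exact: Delta_expands.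
(* The continuations of L^-1 L and L L^-1: no negative power of z is left in them, so they expand at
   0 as well. *)
have pp_exp := expands_comp phi_exp (expands_comp
  (expands_cst 0 (sumP_bounded bP)) phii_exp).
have qq_exp := expands_comp psi_exp (expands_comp
  (expands_cst 0 (sumQ_bounded bQ)) psii_exp).
have coefE i : cauchy_prod (psi_coef D k) (Delta_coef D k) i =1 rS D i.+1.
  by move=> x; exact: psi_Delta_coef.
have eqn : \forall z \near (0 : K), psi z \o Delta z =1 Lz z \o phi z.
  apply: near0_rn.
  exact: (expands_unique coefE (expands_comp psi_exp Delta_exp) S_exp).
have recenter (V : normedModType K) (W : completeNormedModType K)
    (A : nat -> V -> W) (F : K -> V -> W) : expands 0 A F ->
    \forall z \near (0 : K), exists A', expands z A' F.
  by move=> /expands_recenter[d d0 hd]; apply: near0_rn; exists d => // h /hd; rewrite add0r.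
pose Good z := [/\ op_sum (fun i => z ^+ i) L (Lz z),
  op_sum (fun i => z ^+ i) (phi_coef D k) (phi z),
  op_sum (fun i => z ^+ i) (fun i => rS D i.+1) (Lz z \o phi z),
  op_sum (fun i => z ^+ i) (psi_coef D k) (psi z) &
  psi z \o Delta z =1 Lz z \o phi z].
pose Canc z := [/\ cancel (phi_inv z) (phi z), cancel (phi z) (phi_inv z),
  cancel (psi_inv z) (psi z) & cancel (psi z) (psi_inv z)].
pose Bd z := [/\ bounded_op (phi z), bounded_op (psi z), bounded_op (phi_inv z),
  bounded_op (psi_inv z) & bounded_op (Lz z)].
pose An z := [/\ exists A, expands z A phi, exists A, expands z A psi,
  exists A, expands z A psi_inv, exists A, expands z A (fun z => Lz z \o phi z) &
  (exists A, expands z A (fun z => phi z \o (sumP \o phi_inv z))) /\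
  (exists A, expands z A (fun z => psi z \o (sumQ \o psi_inv z)))].
have : \forall z \near (0 : K), [/\ Good z, Canc z, Bd z & An z].
  near=> z; split.
  - split; near: z; [exact: expands0_near L_expands|exact: expands0_near phi_exp|
      exact: expands0_near S_exp|exact: expands0_near psi_exp|exact: eqn].
  - have [] : cancel (phi_inv z) (phi z) /\ cancel (phi z) (phi_inv z).
      by near: z; apply: near0_rn; exact: phi_can.
    have [] : cancel (psi_inv z) (psi z) /\ cancel (psi z) (psi_inv z).
      by near: z; apply: near0_rn; exact: psi_can.
    by [].
  - split; near: z; apply: near0_rn;
      [exact: expands_bounded phi_exp|exact: expands_bounded psi_exp|
       exact: expands_bounded phii_exp|exact: expands_bounded psii_exp|
       exact: expands_bounded L_expands].
  - split; [near: z; exact: recenter phi_exp|near: z; exact: recenter psi_exp|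
      near: z; exact: recenter psii_exp|near: z; exact: recenter S_exp|].
    by split; near: z; [exact: recenter pp_exp|exact: recenter qq_exp].
move=> /near_rnP[d d0 hd].
pose U := [set z : K | rn z < d].
have UP z : U z -> [/\ Good z, Canc z, Bd z & An z].
  by move=> Uz; apply: hd; rewrite subr0.
have U0 : U 0 by rewrite /U /= rn0.
have good z (Uz : U z) : Good z by have [] := UP z Uz.
have canc z (Uz : U z) : Canc z by have [] := UP z Uz.
have bd z (Uz : U z) : Bd z by have [] := UP z Uz.
have an z (Uz : U z) : An z by have [] := UP z Uz.
have phi0 x : phi 0 x = x by rewrite (expands_center phi_exp).
have psi0 x : psi 0 x = x by rewrite (expands_center psi_exp).
have phii0 x : phi_inv 0 x = x by rewrite (expands_center phii_exp).
have psii0 x : psi_inv 0 x = x by rewrite (expands_center psii_exp).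
have phi_ni : near_identity U phi phi_inv.
  split=> // [|z Uz]; last by split; [case: (bd z Uz) | case: (canc z Uz)..].
  by apply: expands_analytic_on => z /an[].
have psi_ni : near_identity U psi psi_inv.
  split=> // [|z Uz]; last by split; [case: (bd z Uz) | case: (canc z Uz)..].
  by apply: expands_analytic_on => z /an[].
(* T_(k+1) sends S_(k+1) x back to x for a nonzero x in N_(k+1)^c. *)
have Tk_neq0 : exists y, Delta_inv_coef D k 0 y != 0.
  have [x Nx x0] := Nc_neq0; exists (rS D k.+1 x).
  rewrite /Delta_inv_coef leq0n subn0 (Q_R (j := k.+1)) ?eqxx //.
    by rewrite rSinv_def.
  by apply: S_in_R => //; exact: (Nc_sub _ Nx).
have Dic_exp : expands 0 (Delta_inv_coef D k) (fun z => psum (Delta_inv_coef D k) z k.+1).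
  exact: Delta_inv_coef_expands.
exists U, phi_inv, psi_inv => /=; split; [split=> //|split; [split|split; [|split; [|split; [|split; [|split]]]]]].
- exact: open_disc.
- by split=> // z /good[].
- split=> //.
  + split; first exact: (expands_coef_bounded phi_exp).
    by move=> z /good[].
  + by apply: expands_analytic_on => z /an[].
  + split; first by move=> i; exact: bS.
    by move=> z /good[].
- split.
  + move=> i ik; have i1 : (1 <= i)%N by case/andP: ik.
    split.
    * by move=> _ [x _ <-]; exact: S_in_Rc.
    * apply/seteqP; split=> [_ [x Nx <-]|y Ry].
        by apply: S_in_R => //; exact: Nc_sub.
      exact: (R_Nc i1 (S_linear L_linear D i1) Ry).
    * apply/seteqP; split=> [_ [x Nx <-]|_ ->]; first exact: (S_N i1 Nx).
      exists 0; first by apply: subspace0; exact: N_subspace.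
      exact: (lin_map0 (S_linear L_linear D i1)).
  + move=> l l2; have kl1 : (1 <= k + l)%N by lia.
    split.
    * move=> _ [x _ <-]; apply: (Rc_decr (j := (k + l).-1)); first lia.
      exact: S_in_Rc.
    * apply/seteqP; split=> [_ [x Nx <-]|_ ->]; first exact: (S_N_stab N_stab kl1 Nx).
      exists 0; first by apply: subspace0; exact: N_subspace.
      exact: (lin_map0 (S_linear L_linear D kl1)).
- split=> //.
  + split; first exact: (expands_coef_bounded psi_exp).
    by move=> z /good[].
  + move=> z Uz; have [_ _ _ _ e] := good z Uz; have [c1 c2 c3 c4] := canc z Uz.
    exact: psi_inv_L_phi.
- have ker z : U z -> z != 0 -> op_kernel (Lz z) = phi z @` rN D k.+1.
    move=> Uz z0; have [_ _ _ _ e] := good z Uz; have [c1 c2 c3 c4] := canc z Uz.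
    have [b1 b2 b3 b4 b5] := bd z Uz.
    exact: (@kernel_Lz z (phi_inv z) (psi_inv z)).
  have ran z : U z -> z != 0 -> range (Lz z) = psi z @` sumR.
    move=> Uz z0; have [_ _ _ _ e] := good z Uz; have [c1 c2 c3 c4] := canc z Uz.
    exact: (@range_Lz z (phi_inv z)).
  split=> //; split=> //.
  + by exists phi, phi_inv, (rN D k.+1); split=> //; exact: N_subspace.
  + exists psi, psi_inv, sumR; split=> //.
    split; first by apply/sum_R; apply: (lin_map0 (sumQ_bounded bQ).1).
    move=> a u v /sum_R uR /sum_R vR; apply/sum_R.
    rewrite -[LHS]/(sumQ (a *: u + v)) (sumQ_bounded bQ).1.
    by congr (_ *: _ + _).
- split.
  + by move=> z z0; exact: Delta_generalized_inverse.
  + apply: (expands_pole Dic_exp) => //.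
    by near=> z => zk y; exact: Delta_invE.
  + move=> z Uz z0; have [_ _ _ _ e] := good z Uz; have [c1 c2 c3 c4] := canc z Uz.
    have [b1 b2 b3 b4 b5] := bd z Uz.
    exact: Linv_generalized_inverse.
  + apply: expands_analytic_on => z [Uz /eqP z0].
    have [[A1 h1] _ [A2 h2] _ _] := an z Uz.
    have [A3 h3] := Delta_inv_expands k bT z0.
    by eexists; exact: (expands_comp (expands_comp h1 h3) h2).
  (* phi and psi^-1 have leading coefficient I, so the Laurent expansion of L^-1 starts with
     T_(k+1), as that of Delta^-1 does. *)
  + have ex := expands_comp (expands_comp phi_exp Dic_exp) psii_exp.
    apply: (expands_pole ex).
      have [y y0] := Tk_neq0; exists y.
      by rewrite /cauchy_prod !big_nat1 subnn Nq0.
    near=> z => zk y /=; have Uz : U z.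
      near: z; apply/near_rnP; exists d => // z; by rewrite subr0.
    have [[lphi _] _ _ _ _] := bd z Uz.
    by rewrite Delta_invE // (lin_mapZ lphi).
- split=> z Uz z0; have [_ _ _ _ e] := good z Uz; have [c1 c2 c3 c4] := canc z Uz;
    have [b1 b2 b3 b4 b5] := bd z Uz.
  + exact: Linv_L.
  + exact: L_Linv.
  + exact: Linv_L_projection.
  + split; first exact: (@L_Linv_projection z (phi_inv z)).
    exact: (@range_Lz z (phi_inv z)).
- exists (fun z => phi z \o (sumP \o phi_inv z)); split.
  + by apply: expands_analytic_on => z /an[_ _ _ _ []].
  + move=> z Uz z0 x; have [_ _ _ _ e] := good z Uz; have [c1 c2 c3 c4] := canc z Uz.
    by rewrite (@Linv_L z (phi_inv z) (psi_inv z)).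
  + by move=> x /=; rewrite phi0 phii0.
- exists (fun z => psi z \o (sumQ \o psi_inv z)); split.
  + by apply: expands_analytic_on => z /an[_ _ _ _ []].
  + move=> z Uz z0 x; have [_ _ _ _ e] := good z Uz; have [c1 c2 c3 c4] := canc z Uz.
    by rewrite (@L_Linv z (phi_inv z) (psi_inv z)).
  + by move=> x /=; rewrite psi0 psii0.
Unshelve. all: by end_near. Qed.

End Main.

End RealNorm.

Theorem theorem3 (R : realType) (K : numFieldType)
  (hK : K = R :> numFieldType \/ K = R[i] :> numFieldType)
  (B Bb : completeNormedModType K) (L : nat -> B -> Bb)
  (L_bounded : forall i, bounded_op (L i))
  (L_analytic : \forall z \near (0 : K),
     op_sum (fun i => z ^+ i) L (op_series L z))
  (L_neq0 : ~ \forall z \near (0 : K), forall x, op_series L z x = 0)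
  (k : nat) (L_stab : stabilizes L R k)
  (D : recursion L)
  (P_cont : forall i, (1 <= i <= k.+1)%N -> continuous (rP D i))
  (Q_cont : forall i, (1 <= i <= k.+1)%N -> continuous (rQ D i)) :
  exists (U : set K) (phi_inv : K -> B -> B) (psi_inv : K -> Bb -> Bb),
    let Lz := op_series L in
    let Sz := fun z => Lz z \o phi D k z in
    let Linv := fun z => phi D k z \o Delta_inv D k z \o psi_inv z in
    let sumNc := sum_spaces 1 k.+1 (rNc D) in
    let sumR := sum_spaces 1 k.+1 (rR D) in
    [/\ open U, U 0 & power_series_on U L Lz] /\
    (* (i) *)
    ([/\ near_identity U (phi D k) phi_inv,
         power_series_on U (phi_coef D k) (phi D k),
         analytic_on U Sz &
         power_series_on U (fun i => rS D i.+1) Sz]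
     /\
     (forall i, (1 <= i <= k.+1)%N ->
        [/\ rS D i @` sum_spaces 0 i.-1 (rNc D) `<=` rRc D i.-1,
            rS D i @` rNc D i = rR D i &
            rS D i @` rN D i = [set 0]]) /\
     (forall l, (2 <= l)%N ->
        range (rS D (k + l)) `<=` rRc D k.+1 /\
        rS D (k + l) @` rN D k.+1 = [set 0])) /\
    (* (ii) *)
    [/\ near_identity U (psi D k) psi_inv,
        power_series_on U (psi_coef D k) (psi D k) &
        forall z, U z -> psi_inv z \o Lz z \o phi D k z =1 Delta D k z] /\
    (* (iii) *)
    [/\ forall z, U z -> z != 0 -> op_kernel (Lz z) = phi D k z @` rN D k.+1,
        forall z, U z -> z != 0 -> range (Lz z) = psi D k z @` sumR,
        analytically_embedded U (fun z => op_kernel (Lz z))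
          (fun z => phi D k z @` rN D k.+1) &
        analytically_embedded U (fun z => range (Lz z))
          (fun z => psi D k z @` sumR)] /\
    (* (iv) *)
    [/\ forall z, z != 0 -> generalized_inverse (Delta D k z) (Delta_inv D k z),
        pole_of_order k (Delta_inv D k),
        forall z, U z -> z != 0 -> generalized_inverse (Lz z) (Linv z),
        analytic_on (U `\ 0) Linv &
        pole_of_order k Linv] /\
    [/\ forall z, U z -> z != 0 ->
          Linv z \o Lz z =1 phi D k z \o sumP D k \o phi_inv z,
        forall z, U z -> z != 0 ->
          Lz z \o Linv z =1 psi D k z \o sumQ D k \o psi_inv z,
        forall z, U z -> z != 0 ->
          projection_onto (Linv z \o Lz z) (phi D k z @` sumNc) &
        forall z, U z -> z != 0 ->
          projection_onto (Lz z \o Linv z) (range (Lz z)) /\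
          range (Lz z) = psi D k z @` sumR] /\
    continues_to_0 U (fun z => Linv z \o Lz z) (sumP D k) /\
    continues_to_0 U (fun z => Lz z \o Linv z) (sumQ D k).
Proof.
(* The real and the complex case are distinguished only here, in the way norms are read as real
   numbers. *)
have [rs] : inhabited (real_scalars R K).
  by case: hK => ->; constructor; [exact: real_scalars_real | exact: real_scalars_complex].
have L_linear i : linear (L i) by case: (L_bounded i).
apply: (near_identity_normal_form (rs := rs)) => //.
- exact: op_sum_near0_expands.
- exact: (stabilizes_N L_linear L_stab).
- exact: (stabilizes_Nc L_linear D L_stab).
Qed.
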